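(* Let $K$ be an algebraically closed field of characteristic $0$, $n\in\mathbb{N}$, let $\widetilde Z\subseteq\mathbb{P}^n_K$ be a projective (closed sub)scheme, let $p\in\mathbb{P}^n_K\setminus\widetilde Z$ be a closed point, and let $\pi:\widetilde Z\twoheadrightarrow Z\subseteq\mathbb{P}^{n-1}_K$ be the outer simple linear projection from $p$. Let $x\in R_1\setminus\mathfrak{p}_1$ be a linear form not vanishing at $p$. Let $\lambda$ be a partition of $k\in\mathbb{N}$. Then $Z_\lambda$ is set-theoretically defined by the ideal of $S$ generated by all elements of the form $F(f)$ with $F\in I(X_\lambda)$ and $f\in(I_{\widetilde Z})^\circ_{x,k}$ together with $\mathfrak{K}^p_{k-1}(I_{\widetilde Z})$.
   Context: Notation. $\mathbb{N}$ denotes the positive integers. $R=K[x_0,\dots,x_n]$ is the homogeneous coordinate ring of $\mathbb{P}^n_K$, $\mathfrak{p}\subset R$ is the homogeneous ideal of $p$, $\mathfrak{p}_1$ its space of linear forms, and $S:=K[\mathfrak{p}_1]\subset R$ the $K$-subalgebra generated by $\mathfrak{p}_1$. The simple linear projection $\mathbb{P}^n_K\setminus\{p\}\to\mathbb{P}^{n-1}_K=\mathrm{Proj}(S)$ is given by the inclusion $S\hookrightarrow R$; $\pi$ is its restriction to $\widetilde Z$ and $Z$ is the image of $\widetilde Z$. $I_{\widetilde Z}\subseteq R$ is the saturated homogeneous ideal with $\widetilde Z=\mathrm{Proj}(R/I_{\widetilde Z})$. A set $Y$ of closed points of $\mathbb{P}^{n-1}_K$ is set-theoretically defined by an ideal $J\subseteq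 S$ if, for every closed point $q\in\mathbb{P}^{n-1}_K$ with homogeneous ideal $\mathfrak{q}\subset S$, one has $q\in Y\iff J\subseteq\mathfrak{q}$. Fibers. For a closed point $q\in Z$ with homogeneous ideal $\mathfrak{q}\subset S$, the projective line $\langle q,p\rangle=\mathbb{P}^1_K$ spanned by $q$ and $p$ is $\mathrm{Proj}(R/\mathfrak{q}R)$. The fiber $\pi^{-1}(q)=\widetilde Z\cap\langle q,p\rangle$ is a closed subscheme of finite length of $\langle q,p\rangle$, hence an effective divisor on $\mathbb{P}^1_K$; its length is the degree of this divisor. For $k\in\mathbb{N}$, $Z_k$ is the set of closed points $q\in Z$ such that $\pi^{-1}(q)$ has length $\geq k$. Partitions. A partition of $k$ is a family $\lambda=(\lambda_1,\dots,\lambda_e)$ of positive integers with $\lambda_1+\dots+\lambda_e=k$. The $\lambda$-ramification locus of $\pi$ is $$Z_\lambda:=\Big\{q\in Z\text{ closed point}\ \Big|\ \exists\,\widetilde q_1,\dots,\widetilde q_e\in\langle q,p\rangle:\ \pi^{-1}(q)=\sum_{i=1}^e\lambda_i\widetilde q_i\Big\}\cup Z_{k+1},$$ where the closed points $\widetilde q_1,\dots,\widetilde q_e$ need not be distinct and the equality is one of divisors on $\langle q,p\rangle$. Polynomials in $x$. Since $x\in R_1\setminus\mathfrak{p}_1$, $R=S[x]$; for $f\in R$, $\deg_x(f)$ is its degree as a polynomial in $x$ over $S$. $(I_{\widetilde Z})^\circ_{x,k}$ is the set of (homogeneous) $f\in I_{\widetilde Z}$ with $\deg_x(f)=k$. For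 $m\in\mathbb{N}_0$, the $m$-th partial elimination ideal of $I_{\widetilde Z}$ with respect to $p$ is $$\mathfrak{K}^p_m(I_{\widetilde Z}):=\{f_0\in S\mid\exists\,\widetilde f\in R:\ \deg_x(\widetilde f)<m\ \text{and}\ x^mf_0+\widetilde f\in I_{\widetilde Z}\}$$ (for $m=0$ this means $\widetilde f=0$, so that $\mathfrak{K}^p_0(I_{\widetilde Z})=I_{\widetilde Z}\cap S$); it is a graded ideal of $S$ independent of the choice of $x$. Coincident root loci. Let $K[x,y]$ be a polynomial ring in two variables. A point $(a_0:\dots:a_k)\in\mathbb{P}^k_K$ is identified with the binary form $\sum_{j=0}^ka_jx^{k-j}y^j$ up to a nonzero scalar. For a partition $\lambda=(\lambda_1,\dots,\lambda_e)$ of $k$, the $\lambda$-coincident root locus $X_\lambda\subseteq\mathbb{P}^k_K$ is the projective variety of binary forms of degree $k$ that can be written as $\prod_{i=1}^eL_i^{\lambda_i}$ with linear forms $L_1,\dots,L_e\in K[x,y]_1$ (not necessarily distinct). $K[z_0,\dots,z_k]$ is the homogeneous coordinate ring of $\mathbb{P}^k_K$ (with $z_j$ corresponding to $a_j$), and $I(X_\lambda)\subseteq K[z_0,\dots,z_k]$ is the homogeneous vanishing ideal of $X_\lambda$. Evaluation. For $f=\sum_{i=0}^kf_ix^{k-i}\in R$ with $f_0,\dots,f_k\in S$ and $F\in K[z_0,\dots,z_k]$, set $F(f):=F(f_0,\dots,f_k)\in S$. *)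

(* Defs.v *)
From HB Require Import structures.
From mathcomp Require Import all_boot all_order all_algebra.
From mathcomp Require Export mpoly.

Set Implicit Arguments.
Unset Strict Implicit.
Unset Printing Implicit Defensive.

Import GRing.Theory.
Local Open Scope ring_scope.

(* A closed point of P^(m-1) over the algebraically closed field K is a nonzero
   row vector u : 'rV[K]_m up to a nonzero scalar; (u == v)%MS says that u and
   v are the same point. *)
Definition evalv (K : closedFieldType) (m : nat) (u : 'rV[K]_m)
  (f : {mpoly K[m]}) : K := f.@[fun i => u 0 i].

(* Non-homogeneous elements are tested degree by degree, so that this is the
   homogeneous ideal of the point, not the maximal ideal of the vector u. *)
Definition point_ideal (K : closedFieldType) (m : nat) (u : 'rV[K]_m)
  (f : {mpoly K[m]}) : Prop :=
  forall d : nat, evalv u (pihomog mdeg d f) = 0.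

Definition vanishing_ideal (K : closedFieldType) (m : nat)
  (X : 'rV[K]_m -> Prop) (f : {mpoly K[m]}) : Prop :=
  forall u : 'rV[K]_m, X u -> point_ideal u f.

Definition homogeneous_ideal (K : closedFieldType) (m : nat)
  (I : {mpoly K[m]} -> Prop) : Prop :=
  [/\ I 0,
      forall f g, I f -> I g -> I (f + g),
      forall r f, I f -> I (r * f) &
      forall f (d : nat), I f -> I (pihomog mdeg d f)].

Definition saturated_ideal (K : closedFieldType) (m : nat)
  (I : {mpoly K[m]} -> Prop) : Prop :=
  forall f, (forall i : 'I_m, exists N : nat, I ('X_i ^+ N * f)) -> I f.

(* The closed subscheme Proj (R / I) is represented by its saturated
   homogeneous ideal I; this says that the closed point u lies on it. *)
Definition on_scheme (K : closedFieldType) (m : nat)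
  (I : {mpoly K[m]} -> Prop) (u : 'rV[K]_m) : Prop :=
  forall f, I f -> point_ideal u f.

Definition linear_forms_at (K : closedFieldType) (m : nat) (p : 'rV[K]_m)
  (l : {mpoly K[m]}) : Prop :=
  l \is 1.-homog /\ point_ideal p l.

Inductive subalgebra_gen (K : closedFieldType) (m : nat)
  (G : {mpoly K[m]} -> Prop) : {mpoly K[m]} -> Prop :=
| SubalgGen f : G f -> subalgebra_gen G f
| SubalgConst (c : K) : subalgebra_gen G c%:MP
| SubalgAdd f g :
    subalgebra_gen G f -> subalgebra_gen G g -> subalgebra_gen G (f + g)
| SubalgMul f g :
    subalgebra_gen G f -> subalgebra_gen G g -> subalgebra_gen G (f * g).

(* The ring S = K[p_1], as a subset of R. *)
Definition proj_ring (K : closedFieldType) (m : nat) (p : 'rV[K]_m) :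
  {mpoly K[m]} -> Prop :=
  subalgebra_gen (linear_forms_at p).

Inductive ideal_gen (K : closedFieldType) (m : nat)
  (S G : {mpoly K[m]} -> Prop) : {mpoly K[m]} -> Prop :=
| IdealGen f : G f -> ideal_gen S G f
| IdealZero : ideal_gen S G 0
| IdealAdd f g : ideal_gen S G f -> ideal_gen S G g -> ideal_gen S G (f + g)
| IdealMul s f : S s -> ideal_gen S G f -> ideal_gen S G (s * f).

(* The space of linear forms on P^(m-2) = Proj S is p_1, the annihilator of p;
   hence a closed point of Proj S is a nonzero class of K^m / <p>, up to
   a nonzero scalar, i.e. a line through p.  It is represented by any vector q
   outside <p>, and q, q' represent the same point iff (p + q == p + q')%MS.
   Elements of S are constant along <p>, so their values at q only depend on
   the class of q modulo <p>. *)
Definition target_point (K : closedFieldType) (m : nat) (p q : 'rV[K]_m) :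
  Prop :=
  ~~ (q <= p)%MS.

Definition target_point_ideal (K : closedFieldType) (m : nat)
  (p q : 'rV[K]_m) (f : {mpoly K[m]}) : Prop :=
  proj_ring p f /\ point_ideal q f.

Definition set_theoretically_defined (K : closedFieldType) (m : nat)
  (p : 'rV[K]_m) (Y : 'rV[K]_m -> Prop) (J : {mpoly K[m]} -> Prop) : Prop :=
  forall q, target_point p q ->
    (Y q <-> (forall f, J f -> target_point_ideal p q f)).

Definition image_point (K : closedFieldType) (m : nat)
  (I : {mpoly K[m]} -> Prop) (p q : 'rV[K]_m) : Prop :=
  target_point p q /\
  exists u : 'rV[K]_m,
    [/\ target_point p u, on_scheme I u & (p + u == p + q)%MS].

(* (s : t) |-> s p + t q is an isomorphism of P^1 with the line <q, p>; the
   restriction f |-> f (s p + t q) is the corresponding isomorphism of R / qR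
   with K[s, t]. *)
Definition restrict_line (K : closedFieldType) (m : nat) (p q : 'rV[K]_m)
  (f : {mpoly K[m]}) : {mpoly K[2]} :=
  f \mPo [tuple (p 0 i) *: 'X_ord0 + (q 0 i) *: 'X_ord_max | i < m].

Definition fiber_ideal (K : closedFieldType) (m : nat)
  (I : {mpoly K[m]} -> Prop) (p q : 'rV[K]_m) (h : {mpoly K[2]}) : Prop :=
  exists2 f, I f & h = restrict_line p q f.

(* The linear form on P^1 whose only zero is the point P. *)
Definition point_form (K : closedFieldType) (P : 'rV[K]_2) : {mpoly K[2]} :=
  (P 0 ord_max) *: 'X_ord0 - (P 0 ord0) *: 'X_ord_max.

Definition vanishes_to_order (K : closedFieldType)
  (J : {mpoly K[2]} -> Prop) (P : 'rV[K]_2) (a : nat) : Prop :=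
  forall h, J h -> exists g, h = point_form P ^+ a * g.

(* The divisor of the subscheme of P^1 defined by the homogeneous ideal J has
   multiplicity a at P. *)
Definition multiplicity_at (K : closedFieldType)
  (J : {mpoly K[2]} -> Prop) (P : 'rV[K]_2) (a : nat) : Prop :=
  vanishes_to_order J P a /\ ~ vanishes_to_order J P a.+1.

(* The subscheme of P^1 defined by J, as an effective divisor, equals
   \sum_i mu i . Q i; the points Q i need not be distinct. *)
Definition is_divisor (K : closedFieldType) (J : {mpoly K[2]} -> Prop)
  (e : nat) (mu : 'I_e -> nat) (Q : 'I_e -> 'rV[K]_2) : Prop :=
  (forall i, Q i != 0) /\
  forall P : 'rV[K]_2, P != 0 ->
    multiplicity_at J P (\sum_(i < e | (Q i == P)%MS) mu i)%N.

Definition fiber_length_ge (K : closedFieldType) (m : nat)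
  (I : {mpoly K[m]} -> Prop) (p q : 'rV[K]_m) (k : nat) : Prop :=
  exists (e : nat) (mu : 'I_e -> nat) (Q : 'I_e -> 'rV[K]_2),
    is_divisor (fiber_ideal I p q) mu Q /\ (k <= \sum_(i < e) mu i)%N.

Definition Zlen (K : closedFieldType) (m : nat)
  (I : {mpoly K[m]} -> Prop) (p : 'rV[K]_m) (k : nat) (q : 'rV[K]_m) : Prop :=
  image_point I p q /\ fiber_length_ge I p q k.

Definition is_partition (k e : nat) (lam : 'I_e -> nat) : Prop :=
  (forall i, (0 < lam i)%N) /\ (\sum_(i < e) lam i)%N = k.

Definition Zlam (K : closedFieldType) (m : nat)
  (I : {mpoly K[m]} -> Prop) (p : 'rV[K]_m) (k e : nat) (lam : 'I_e -> nat)
  (q : 'rV[K]_m) : Prop :=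
  (image_point I p q /\
   exists Q : 'I_e -> 'rV[K]_2, is_divisor (fiber_ideal I p q) lam Q)
  \/ Zlen I p k.+1 q.

(* f = c.[x] with coefficients in S; as R = S[x] is a polynomial ring over S,
   c is determined by f, and deg_x f = (size c).-1 when f != 0. *)
Definition x_expansion (K : closedFieldType) (m : nat) (p : 'rV[K]_m)
  (x : {mpoly K[m]}) (c : {poly {mpoly K[m]}}) (f : {mpoly K[m]}) : Prop :=
  (forall i, proj_ring p c`_i) /\ f = c.[x].

(* c is the x-expansion of a homogeneous element of I with deg_x = k. *)
Definition ideal_deg_x (K : closedFieldType) (m : nat)
  (I : {mpoly K[m]} -> Prop) (p : 'rV[K]_m) (x : {mpoly K[m]}) (k : nat)
  (c : {poly {mpoly K[m]}}) : Prop :=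
  exists f, [/\ I f, f \is homog mdeg, x_expansion p x c f & size c = k.+1].

(* deg_x (ft) < j means size ct <= j, with deg_x 0 = -oo. *)
Definition partial_elimination_ideal (K : closedFieldType) (m : nat)
  (I : {mpoly K[m]} -> Prop) (p : 'rV[K]_m) (x : {mpoly K[m]}) (j : nat)
  (f0 : {mpoly K[m]}) : Prop :=
  proj_ring p f0 /\
  exists ct ft,
    [/\ x_expansion p x ct ft, (size ct <= j)%N & I (x ^+ j * f0 + ft)].

Definition binary_form (K : closedFieldType) (k : nat) (a : 'rV[K]_k.+1) :
  {mpoly K[2]} :=
  \sum_(j < k.+1) a 0 j *: ('X_ord0 ^+ (k - j) * 'X_ord_max ^+ j).

Definition coincident_root_locus (K : closedFieldType) (k e : nat)
  (lam : 'I_e -> nat) (a : 'rV[K]_k.+1) : Prop :=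
  a != 0 /\
  exists (c : K) (L : 'I_e -> {mpoly K[2]}),
    [/\ c != 0, forall i, L i \is 1.-homog &
        binary_form a = c *: \prod_(i < e) L i ^+ lam i].

(* F(f_0, ..., f_k) for f = \sum_i f_i x^(k - i). *)
Definition eval_coefs (K : closedFieldType) (m k : nat) (F : {mpoly K[k.+1]})
  (c : {poly {mpoly K[m]}}) : {mpoly K[m]} :=
  mmap (@mpolyC m K) (fun i : 'I_k.+1 => c`_(k - i)) F.

Definition ramification_generator (K : closedFieldType) (m : nat)
  (I : {mpoly K[m]} -> Prop) (p : 'rV[K]_m) (x : {mpoly K[m]})
  (k e : nat) (lam : 'I_e -> nat) (g : {mpoly K[m]}) : Prop :=
  (exists (F : {mpoly K[k.+1]}) (c : {poly {mpoly K[m]}}),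
     [/\ vanishing_ideal (coincident_root_locus lam) F,
         ideal_deg_x I p x k c & g = eval_coefs F c])
  \/ partial_elimination_ideal I p x k.-1 g.

Definition ramification_ideal (K : closedFieldType) (m : nat)
  (I : {mpoly K[m]} -> Prop) (p : 'rV[K]_m) (x : {mpoly K[m]})
  (k e : nat) (lam : 'I_e -> nat) : {mpoly K[m]} -> Prop :=
  ideal_gen (proj_ring p) (ramification_generator I p x k lam).

(* Main.v *)
Require Import Defs.
From HB Require Import structures.
From mathcomp Require Import all_boot all_order all_algebra.
From mathcomp Require Import fingroup perm ring zify.
From Stdlib Require Import Classical_Prop.

Set Implicit Arguments.
Unset Strict Implicit.
Unset Printing Implicit Defensive.

Import GRing.Theory.
Local Open Scope ring_scope.

(** Choose a representative q of a point of P^(n-1).  Every f in R has a unique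
    expansion in powers of x with coefficients in S ([expand]), and elements of
    S are constant along the line through p and q; hence restricting f to that
    line means evaluating the coefficients of its expansion at q, which gives a
    polynomial in one variable ([line_poly]).  The restrictions of the elements
    of I form an ideal of K[X], with generator g, nonzero because p is not on
    the scheme.  The root multiplicities of g are the multiplicities of the
    fiber, so the length of the fiber is deg g, and q lies in the ramification
    locus exactly when deg g > k or g is a scalar multiple of a product of
    powers (X - r_i)^(lam_i) ([ZlamE]).

    Suppose that q lies in the locus, so that deg g >= k.  An element of I of
    degree less than k in x restricts to a multiple of g of smaller degree,
    that is, to zero; so the partial elimination ideal vanishes at q.  If f in I
    has degree k in x, its restriction is zero or a scalar multiple of g, and
    in the second case g has the prescribed root multiplicities; so its
    coefficients at q form zero or a point of the coincident root locus, where
    F vanishes.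

    Conversely, Nakayama's lemma for R / I, a finite module over S, yields forms
    in I of every degree j >= deg g in x whose leading coefficient does not
    vanish at q ([low_degree_element], [form_of_exact_degree]).  With j = k-1
    this shows that deg g >= k if the partial elimination ideal vanishes at q.
    If deg g = k, the case j = k gives f in I that restricts to a scalar
    multiple of g, and all F in the ideal of the coincident root locus vanish
    at the coefficients of g.  It remains to know that this locus is closed
    where the leading coefficient is nonzero ([coincident_root_locus_closed]):
    a monic polynomial whose roots cannot be ordered so as to be constant on the
    blocks of the partition is separated from the locus by a symmetric
    polynomial in the roots, which is a polynomial in the coefficients. *)

(** * Polynomials and homogeneous components *)

Section PolynomialPrinciples.

Variables (K : closedFieldType) (m : nat).
Implicit Types (f g : {mpoly K[m]}) (u : 'rV[K]_m).

Lemma mpoly_ring_ind (P : {mpoly K[m]} -> Prop) :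
  (forall c, P c%:MP) -> (forall i, P 'X_i) ->
  (forall f g, P f -> P g -> P (f + g)) ->
  (forall f g, P f -> P g -> P (f * g)) -> forall f, P f.
Proof.
move=> PC PX PD PM f; rewrite [f]mpolyE.
elim/big_ind: _ => [||mm _]; [by rewrite -mpolyC0 | exact: PD |].
rewrite -mul_mpolyC; apply: (PM) => //; rewrite mpolyXE_id.
elim/big_ind: _ => [||i _]; [by rewrite -mpolyC1 | exact: (PM) |].
by elim: (mm i) => [|j IH]; [rewrite expr0 -mpolyC1 | rewrite exprS; apply: (PM)].
Qed.

Lemma dhomog_ind (P : nat -> {mpoly K[m]} -> Prop) :
  (forall d, P d 0) -> (forall c, P 0 c%:MP) -> (forall i, P 1 'X_i) ->
  (forall d f g, P d f -> P d g -> P d (f + g)) ->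
  (forall d e f g, P d f -> P e g -> P (d + e)%N (f * g)) ->
  forall d f, f \is d.-homog -> P d f.
Proof.
move=> P0 PC PX PD PM d f /dhomogP hf; rewrite [f]mpolyE big_seq.
elim/big_ind: _ => [|f1 f2|mm /hf mf_mm]; [exact: P0 | exact: PD |].
rewrite -mul_mpolyC -[d]add0n; apply: (PM); first exact: PC.
have -> : d = (\sum_i mm i)%N by rewrite -mf_mm; exact: mdegE.
rewrite mpolyXE_id.
elim/big_ind2: _ => [|d1 f1 d2 f2|i _]; [by rewrite -mpolyC1 | exact: (PM) |].
elim: (mm i) => [|j IH]; first by rewrite expr0 -mpolyC1.
by rewrite exprS -add1n; apply: (PM).
Qed.

Lemma linear_formE f : f \is 1.-homog -> f = \sum_i f@_U_(i) *: 'X_i.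
Proof.
move=> hf; apply/mpolyP => mm; rewrite raddf_sum /=.
under eq_bigr do rewrite mcoeffZ mcoeffX.
have [/eqP/mdeg1P [j /eqP ->]|mm_neq1] := eqVneq (mdeg mm) 1%N.
  rewrite (bigD1 j) //= eqxx mulr1 big1 ?addr0 // => i ne_ij.
  by rewrite eq_mnm1 (negbTE ne_ij) mulr0.
rewrite (dhomog_nemf_coeff hf mm_neq1) big1 // => i _.
case: eqP => [eq_mm|_]; last by rewrite mulr0.
by move: mm_neq1; rewrite -eq_mm mdeg1.
Qed.

Lemma dhomogXU i : ('X_i : {mpoly K[m]}) \is 1.-homog.
Proof. by rewrite dhomogX; apply/eqP; exact: mdeg1. Qed.

Lemma dhomogC (c : K) : (c%:MP : {mpoly K[m]}) \is 0.-homog.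
Proof. by rewrite -alg_mpolyC; apply/dhomogZ/dhomog1. Qed.

Lemma homogeneous_partition f : f = \sum_(d < msize f) pihomog mdeg d f.
Proof. exact: pihomog_partitionE. Qed.

Lemma pihomog_large d f : (msize f <= d)%N -> pihomog mdeg d f = 0.
Proof.
move=> le_fd; rewrite pihomogE big_seq_cond big_pred0 // => mm.
apply/negbTE/negP => /andP [/msize_mdeg_lt lt_mm /eqP dE].
by move: (leq_trans lt_mm le_fd); rewrite dE ltnn.
Qed.

HB.instance Definition _ u := GRing.RMorphism.copy (evalv u) (evalv u).

Lemma evalvC u c : evalv u c%:MP = c.
Proof. exact: mevalC. Qed.

Lemma evalvX u i : evalv u 'X_i = u 0 i.
Proof. exact: mevalXU. Qed.

Lemma evalvZ u c f : evalv u (c *: f) = c * evalv u f.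
Proof. exact: mevalZ. Qed.

Lemma evalv_scale_homog d f c u :
  f \is d.-homog -> evalv (c *: u) f = c ^+ d * evalv u f.
Proof.
move: d f; apply: dhomog_ind => [d|a|i|d f g ef eg|d e f g ef eg].
- by rewrite !rmorph0 mulr0.
- by rewrite !evalvC mul1r.
- by rewrite !evalvX mxE expr1.
- by rewrite !rmorphD /= ef eg mulrDr.
- by rewrite !rmorphM /= ef eg exprD mulrACA.
Qed.

Lemma evalv_scale f c u :
  evalv (c *: u) f =
  (\poly_(d < msize f) evalv u (pihomog mdeg d f)).[c].
Proof.
rewrite {1}[f]homogeneous_partition rmorph_sum horner_poly /=.
apply: eq_bigr => d _; rewrite (@evalv_scale_homog d) 1?mulrC //.
exact: pihomogP.
Qed.

Lemma point_ideal_scale u f c : point_ideal u f -> evalv (c *: u) f = 0.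
Proof.
move=> fu; rewrite evalv_scale (_ : \poly_(_ < _) _ = 0) ?horner0 //.
by apply/polyP => d; rewrite coef_poly coef0 fu if_same.
Qed.

(** Membership in the homogeneous ideal of a point can be tested on all its
    nonzero representatives: a polynomial in the scaling factor that vanishes
    at infinitely many arguments has zero coefficients. *)
Lemma point_idealP u f :
  point_ideal u f <-> (forall c, c != 0 -> evalv (c *: u) f = 0).
Proof.
split=> [fu c _ | fu d]; first exact: point_ideal_scale.
set P := \poly_(d < msize f) evalv u (pihomog mdeg d f).
suff P0 : P = 0.
  have [lt_d|le_d] := ltnP d (msize f); last by rewrite pihomog_large ?rmorph0.
  by have := congr1 (fun r : {poly K} => r`_d) P0; rewrite /= coef0 coef_poly lt_d.
apply/eqP/contraT => nzP.
have /closed_nonrootP [c] : 'X * P != 0 by rewrite mulf_neq0 ?polyX_eq0.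
rewrite rootM rootX negb_or => /andP [c0 /negP[]].
by apply/rootP; rewrite -evalv_scale fu.
Qed.

Lemma point_ideal_eval u f : point_ideal u f -> evalv u f = 0.
Proof. by move/(point_ideal_scale 1); rewrite scale1r. Qed.

Lemma point_ideal_homog u d f :
  f \is d.-homog -> evalv u f = 0 -> point_ideal u f.
Proof.
by move=> hf fu; apply/point_idealP => c _; rewrite (evalv_scale_homog _ _ hf) fu mulr0.
Qed.

End PolynomialPrinciples.

(** * Expansion of a polynomial in powers of x over the projection ring *)

(** Substituting (X_i - (p_i / x(p)) x) + (p_i / x(p)) X for X_i gives a ring
    morphism from R to R[X]; its coefficients lie in S and it undoes the
    evaluation of X at x, so it computes expansions in S[x]. *)
HB.lock Definition expand (K : closedFieldType) (m : nat) (p : 'rV[K]_m)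
  (x : {mpoly K[m]}) : {mpoly K[m]} -> {poly {mpoly K[m]}} :=
  mmap (polyC \o @mpolyC m K)
       (fun i => ('X_i - (p 0 i / evalv p x) *: x)%:P
                 + (p 0 i / evalv p x)%:MP *: 'X).

Section Expansion.

Variables (K : closedFieldType) (m : nat) (p : 'rV[K]_m) (x : {mpoly K[m]}).
Implicit Types (f g : {mpoly K[m]}) (u : 'rV[K]_m).

Local Notation slope i := (p 0 i / evalv p x).
Local Notation expand := (expand p x).

Lemma expand_is_zmod_morphism : zmod_morphism expand.
Proof. by move=> f g; rewrite unlock rmorphB. Qed.

Lemma expand_is_monoid_morphism : monoid_morphism expand.
Proof. by rewrite unlock; split=> [|f g]; rewrite (rmorph1, rmorphM). Qed.

HB.instance Definition _ :=
  GRing.isZmodMorphism.Build {mpoly K[m]} {poly {mpoly K[m]}} expand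
    expand_is_zmod_morphism.
HB.instance Definition _ :=
  GRing.isMonoidMorphism.Build {mpoly K[m]} {poly {mpoly K[m]}} expand
    expand_is_monoid_morphism.

Lemma expandC c : expand c%:MP = c%:MP%:P.
Proof. by rewrite unlock mmapC. Qed.

Lemma expandX i :
  expand 'X_i = ('X_i - slope i *: x)%:P + (slope i)%:MP *: 'X.
Proof. by rewrite unlock mmapX mmap1U. Qed.

Lemma expandZ c f : expand (c *: f) = c%:MP *: expand f.
Proof. by rewrite -mul_mpolyC rmorphM /= expandC mul_polyC. Qed.

Lemma horner_expand f : (expand f).[x] = f.
Proof.
elim/mpoly_ring_ind: f => [c|i|f g ef eg|f g ef eg].
- by rewrite expandC hornerC.
- by rewrite expandX hornerD hornerC hornerZ hornerX mul_mpolyC subrK.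
- by rewrite rmorphD /= hornerD ef eg.
- by rewrite rmorphM /= hornerM ef eg.
Qed.

Hypothesis x_lin : x \is 1.-homog.

Lemma expand_homog d f i : f \is d.-homog ->
  if (i <= d)%N then (expand f)`_i \is (d - i).-homog else (expand f)`_i == 0.
Proof.
move=> hf; move: d f hf i.
apply: dhomog_ind => [d i|c i|j i|d f g hf hg i|d e f g hf hg i].
- by rewrite rmorph0 coef0 eqxx dhomog0 if_same.
- rewrite expandC coefC; case: i => [|i] //=.
  exact: dhomogC.
- rewrite expandX coefD coefC coefZ coefX; case: i => [|[|i]] /=.
  + rewrite mulr0 addr0; apply: rpredB; last exact: dhomogZ.
    exact: dhomogXU.
  + by rewrite mulr1 add0r dhomogC.
  + by rewrite mulr0 addr0.
- rewrite rmorphD /= coefD; move: (hf i) (hg i); case: leqP => _.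
    exact: dhomogD.
  by move=> /eqP -> /eqP ->; rewrite addr0.
- rewrite rmorphM /= coefM; case: leqP => [le_i|lt_i].
    apply: rpred_sum => j _; move: (hf j) (hg (i - j)%N).
    case: leqP => [le_jd|_]; last by move=> /eqP -> _; rewrite mul0r dhomog0.
    case: leqP => [le_ije|_]; last by move=> _ /eqP ->; rewrite mulr0 dhomog0.
    move=> h1 h2.
    rewrite (_ : (d + e - i)%N = (d - j + (e - (i - j)))%N); first exact: dhomogM.
    by have := ltn_ord j; rewrite ltnS => le_ji; lia.
  apply/eqP/big1 => j _; move: (hf j) (hg (i - j)%N).
  case: leqP => [le_jd|_]; last by move=> /eqP -> _; rewrite mul0r.
  case: leqP => [le_ije|_]; last by move=> _ /eqP ->; rewrite mulr0.
  by have := ltn_ord j; rewrite ltnS => le_ji; lia.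
Qed.

Lemma expand_homog_coef d f i : f \is d.-homog -> (expand f)`_i \is (d - i).-homog.
Proof.
by move/(expand_homog i); case: leqP => // _ /eqP ->; rewrite dhomog0.
Qed.

Lemma size_expand_homog d f : f \is d.-homog -> (size (expand f) <= d.+1)%N.
Proof.
move=> hf; apply/leq_sizeP => i lt_di; have := expand_homog i hf.
by rewrite leqNgt lt_di => /eqP.
Qed.

Lemma expand_pihomog d f i :
  (expand (pihomog mdeg d f))`_i =
  if (i <= d)%N then pihomog mdeg (d - i) (expand f)`_i else 0.
Proof.
case: leqP => [le_id|lt_di]; last first.
  by have := expand_homog i (pihomogP mdeg d f); rewrite leqNgt lt_di => /eqP.
pose N := maxn (msize f) d.+1.
have fE : f = \sum_(c < N) pihomog mdeg c f.
  by apply: pihomog_partitionE; rewrite leq_maxl.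
have lt_dN : (d < N)%N by rewrite leq_max ltnSn orbT.
have -> : (expand f)`_i = \sum_(c < N) (expand (pihomog mdeg c f))`_i.
  by rewrite {1}fE rmorph_sum /= coef_sum.
rewrite [in RHS]raddf_sum /= [in RHS](bigD1 (Ordinal lt_dN)) //=.
rewrite (pihomog_dE (expand_homog_coef i (pihomogP mdeg d f))).
rewrite big1 ?addr0 // => c ne_cd.
have := expand_homog i (pihomogP mdeg c f).
case: leqP => [le_ic h|_ /eqP ->]; last by rewrite raddf0.
rewrite (pihomog_ne0 _ h) //; apply: contra ne_cd => /eqP eq_cd.
by apply/eqP/val_inj => /=; lia.
Qed.

Hypothesis xp_neq0 : evalv p x != 0.

Lemma expand_linear f : f \is 1.-homog ->
  expand f = (f - (evalv p f / evalv p x) *: x)%:P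
             + (evalv p f / evalv p x)%:MP *: 'X.
Proof.
move=> hf; have -> : evalv p f / evalv p x = \sum_i f@_U_(i) * slope i.
  rewrite [in LHS](linear_formE hf) rmorph_sum /= mulr_suml.
  by apply: eq_bigr => i _; rewrite evalvZ evalvX mulrA.
rewrite {1 2}(linear_formE hf) rmorph_sum /= !rmorph_sum /= !scaler_suml.
rewrite -sumrB rmorph_sum -big_split /=; apply: eq_bigr => i _.
rewrite expandZ expandX scalerDr scalerA mpolyCM -scalerA; congr (_ + _).
by rewrite -mul_polyC -polyCM mul_mpolyC scalerBr !scalerA !mulrA.
Qed.

Lemma expand_x : expand x = 'X.
Proof.
by rewrite (expand_linear x_lin) divff // scale1r subrr add0r mpolyC1 scale1r.
Qed.

Lemma expand_linear_form_at l : linear_forms_at p l -> expand l = l%:P.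
Proof.
case=> hl /point_ideal_eval lp; rewrite (expand_linear hl) lp mul0r !scale0r.
by rewrite subr0 addr0.
Qed.

Lemma expand_proj_ring s : proj_ring p s -> expand s = s%:P.
Proof.
elim=> {s} [l|c|f g _ ef _ eg|f g _ ef _ eg].
- exact: expand_linear_form_at.
- exact: expandC.
- by rewrite rmorphD /= ef eg rmorphD.
- by rewrite rmorphM /= ef eg rmorphM.
Qed.

Lemma proj_ring0 : proj_ring p 0.
Proof. by rewrite -mpolyC0; apply: SubalgConst. Qed.

Lemma proj_ring1 : proj_ring p 1.
Proof. by rewrite -mpolyC1; apply: SubalgConst. Qed.

Lemma proj_ring_sum (T : Type) (r : seq T) (P : pred T) (F : T -> {mpoly K[m]}) :
  (forall i, P i -> proj_ring p (F i)) -> proj_ring p (\sum_(i <- r | P i) F i).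
Proof. by move=> h; apply: big_ind => //; [exact: proj_ring0 | exact: SubalgAdd]. Qed.

Lemma proj_ring_prod (T : Type) (r : seq T) (P : pred T) (F : T -> {mpoly K[m]}) :
  (forall i, P i -> proj_ring p (F i)) -> proj_ring p (\prod_(i <- r | P i) F i).
Proof.
by move=> h; apply: big_ind => //; [exact: proj_ring1 | exact: SubalgMul].
Qed.

Lemma proj_ringX f i : proj_ring p f -> proj_ring p (f ^+ i).
Proof.
move=> h; elim: i => [|i IH]; first exact: proj_ring1.
by rewrite exprS; apply: SubalgMul.
Qed.

(** These forms generate R together with x, which is why R = S[x]. *)
Lemma expandX0_linear_form i : linear_forms_at p ('X_i - slope i *: x).
Proof.
have hl : 'X_i - slope i *: x \is 1.-homog.
  by apply: rpredB; [exact: dhomogXU | exact: dhomogZ].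
split=> //; apply: (point_ideal_homog hl).
by rewrite rmorphB /= evalvX evalvZ divfK // subrr.
Qed.

Lemma expand_coef_proj_ring f i : proj_ring p (expand f)`_i.
Proof.
elim/mpoly_ring_ind: f i => [c|j|f g hf hg|f g hf hg] i.
- rewrite expandC coefC; case: eqP => _; last exact: proj_ring0.
  exact: SubalgConst.
- rewrite expandX coefD coefC coefZ coefX; apply: SubalgAdd.
    by case: eqP => _; [exact/SubalgGen/expandX0_linear_form | exact: proj_ring0].
  apply: SubalgMul; first exact: SubalgConst.
  case: eqP => _; last exact: proj_ring0.
  exact: proj_ring1.
- by rewrite rmorphD /= coefD; apply: SubalgAdd; [exact: hf | exact: hg].
- rewrite rmorphM /= coefM; apply: proj_ring_sum => j _.
  by apply: SubalgMul; [exact: hf | exact: hg].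
Qed.

Lemma expand_horner (c : {poly {mpoly K[m]}}) : (forall i, proj_ring p c`_i) -> expand c.[x] = c.
Proof.
move=> hc; rewrite horner_coef rmorph_sum /= -[RHS]coefK poly_def.
apply: eq_bigr => i _.
by rewrite rmorphM rmorphXn /= expand_x expand_proj_ring // mul_polyC.
Qed.

(** Uniqueness of the expansion: a ring morphism that fixes S and sends x to
    the polynomial variable reads the coefficients off. *)
Lemma x_expansionP c f : x_expansion p x c f <-> c = expand f.
Proof.
split=> [[hc ->]|->]; first by rewrite expand_horner.
by split; [exact: expand_coef_proj_ring | rewrite horner_expand].
Qed.

End Expansion.

(** * Homogenization of univariate polynomials *)

Section Homogenize.

Variables (K : closedFieldType) (L T : {mpoly K[2]}).
Implicit Types w v : {poly K}.

Definition homogenize (d : nat) w : {mpoly K[2]} :=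
  \sum_(i < d.+1) w`_i *: (L ^+ i * T ^+ (d - i)).

Lemma homogenizeD d w v : homogenize d (w + v) = homogenize d w + homogenize d v.
Proof.
by rewrite /homogenize -big_split; apply: eq_bigr => i _; rewrite coefD scalerDl.
Qed.

Lemma homogenizeZ d c w : homogenize d (c *: w) = c *: homogenize d w.
Proof.
by rewrite /homogenize scaler_sumr; apply: eq_bigr => i _; rewrite coefZ scalerA.
Qed.

Lemma homogenize0 d : homogenize d 0 = 0.
Proof. by rewrite /homogenize big1 // => i _; rewrite coef0 scale0r. Qed.

Lemma homogenize_sum d n (F : 'I_n -> {poly K}) :
  homogenize d (\sum_i F i) = \sum_i homogenize d (F i).
Proof. exact: (big_morph _ (homogenizeD d) (homogenize0 d)). Qed.

Lemma homogenize_mulXn d i w : homogenize (d + i) (w * 'X^i) = L ^+ i * homogenize d w.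
Proof.
rewrite /homogenize -addSn.
rewrite -(big_mkord xpredT (fun j => (w * 'X^i)`_j *: (L ^+ j * T ^+ (d + i - j)))).
rewrite (big_cat_nat (n := i)) ?leq_addl //= big_nat_cond big1 ?add0r; last first.
  by move=> j /andP [/andP [_ lt_ji] _]; rewrite coefMXn lt_ji scale0r.
rewrite -{1}[i]add0n big_addn addnK big_mkord mulr_sumr.
apply: eq_bigr => j _; rewrite coefMXn ltnNge leq_addl addnK /= -scalerAr mulrA.
by rewrite subnDr addnC exprD.
Qed.

Lemma homogenize_raise d e w : (size w <= d.+1)%N ->
  homogenize (d + e) w = T ^+ e * homogenize d w.
Proof.
move=> le_wd; rewrite /homogenize -addSn big_split_ord /= [X in _ + X]big1 ?addr0.
  rewrite mulr_sumr; apply: eq_bigr => i _; rewrite -scalerAr mulrCA -exprD.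
  by congr (_ *: (_ * _ ^+ _)); have := ltn_ord i; lia.
by move=> i _; rewrite nth_default ?scale0r // (leq_trans le_wd) ?leq_addr.
Qed.

Lemma homogenizeM d e w v : (size w <= d.+1)%N -> (size v <= e.+1)%N ->
  homogenize (d + e) (w * v) = homogenize d w * homogenize e v.
Proof.
move=> le_wd le_ve.
have vE : v = \sum_(i < e.+1) v`_i *: 'X^i.
  rewrite -poly_def; apply/polyP => i; rewrite coef_poly.
  by case: ltnP => // /(leq_trans le_ve) /leq_sizeP ->.
rewrite {1}vE mulr_sumr homogenize_sum /homogenize mulr_sumr.
apply: eq_bigr => i _; rewrite -scalerAr -/(homogenize _ _) homogenizeZ.
rewrite -scalerAr; congr (_ *: _).
have le_ie : (i <= e)%N by rewrite -ltnS.
rewrite -{1}(subnK le_ie) addnA homogenize_mulXn homogenize_raise //.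
by rewrite mulrA mulrC.
Qed.

Lemma homogenizeC d c : homogenize d c%:P = c *: T ^+ d.
Proof.
have le_c1 : (size c%:P <= 1)%N by rewrite size_polyC; case: (c == 0).
rewrite -[d]add0n homogenize_raise // /homogenize big_ord1 coefC /= mulr1.
by rewrite -scalerAr mulr1 add0n.
Qed.

Lemma homogenize_XsubC r : homogenize 1 ('X - r%:P) = L - r *: T.
Proof.
rewrite /homogenize 2!big_ord_recl big_ord0 /= !coefB !coefX !coefC /=.
by rewrite sub0r subr0 scale1r addr0 !mulr1 mul1r scaleNr addrC.
Qed.

Lemma homogenize_XsubC_exp r a d w : (size w <= d.+1)%N ->
  homogenize (a + d) (('X - r%:P) ^+ a * w) = (L - r *: T) ^+ a * homogenize d w.
Proof.
move=> le_wd; elim: a => [|a IH]; first by rewrite !expr0 !mul1r.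
rewrite !exprS -!mulrA -IH -homogenize_XsubC -homogenizeM ?size_XsubC //.
apply: leq_trans (size_polyMleq _ _) _.
by rewrite size_exp_XsubC; lia.
Qed.

End Homogenize.

(** * The restriction of R to a line through p *)

(** The line joining p and q is parametrized by the value of x: the point of
    the affine line q + K p where x takes the value X.  Since the coefficients
    of an expansion are constant along p, restricting f to that line amounts
    to evaluating them at q. *)
HB.lock Definition line_poly (K : closedFieldType) (m : nat) (p : 'rV[K]_m)
  (x : {mpoly K[m]}) (q : 'rV[K]_m) : {mpoly K[m]} -> {poly K} :=
  map_poly (evalv q) \o expand p x.

Section LinePoly.

Variables (K : closedFieldType) (m : nat) (p : 'rV[K]_m) (x : {mpoly K[m]}).
Variable q : 'rV[K]_m.
Implicit Types (f g : {mpoly K[m]}) (u : 'rV[K]_m).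

Local Notation slope i := (p 0 i / evalv p x).
Local Notation line_poly := (line_poly p x q).

Lemma line_poly_is_zmod_morphism : zmod_morphism line_poly.
Proof. by move=> f g; rewrite unlock rmorphB. Qed.

Lemma line_poly_is_monoid_morphism : monoid_morphism line_poly.
Proof. by rewrite unlock; split=> [|f g]; rewrite (rmorph1, rmorphM). Qed.

HB.instance Definition _ :=
  GRing.isZmodMorphism.Build {mpoly K[m]} {poly K} line_poly
    line_poly_is_zmod_morphism.
HB.instance Definition _ :=
  GRing.isMonoidMorphism.Build {mpoly K[m]} {poly K} line_poly
    line_poly_is_monoid_morphism.

Lemma coef_line_poly f i : (line_poly f)`_i = evalv q (expand p x f)`_i.
Proof. by rewrite unlock /= coef_map. Qed.

Lemma size_line_poly f : (size (line_poly f) <= size (expand p x f))%N.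
Proof. by rewrite unlock /= size_poly. Qed.

Lemma line_polyC c : line_poly c%:MP = c%:P.
Proof. by rewrite unlock /= expandC map_polyC /= evalvC. Qed.

Lemma line_polyX i :
  line_poly 'X_i = (q 0 i - slope i * evalv q x)%:P + slope i *: 'X.
Proof.
rewrite unlock /= expandX rmorphD /= map_polyC map_polyZ map_polyX /=.
by rewrite rmorphB /= evalvC evalvX evalvZ.
Qed.

Hypothesis x_lin : x \is 1.-homog.
Hypothesis xp_neq0 : evalv p x != 0.

Lemma horner_line_poly f s :
  (line_poly f).[evalv q x + s * evalv p x] = evalv (q + s *: p) f.
Proof.
elim/mpoly_ring_ind: f => [c|i|f g ef eg|f g ef eg].
- by rewrite line_polyC hornerC evalvC.
- rewrite line_polyX !hornerE evalvX !mxE; field.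
  exact: xp_neq0.
- by rewrite !rmorphD /= hornerD ef eg.
- by rewrite !rmorphM /= hornerM ef eg.
Qed.

Lemma line_poly_x : line_poly x = 'X.
Proof. by rewrite unlock /= expand_x // map_polyX. Qed.

Lemma line_poly_proj_ring s : proj_ring p s -> line_poly s = (evalv q s)%:P.
Proof. by move=> hs; rewrite unlock /= expand_proj_ring // map_polyC. Qed.

Lemma size_line_poly_homog d f :
  f \is d.-homog -> (size (line_poly f) <= d.+1)%N.
Proof.
by move=> hf; apply: leq_trans (size_line_poly f) (size_expand_homog p x_lin hf).
Qed.

Lemma line_poly_surj w : exists f, line_poly f = w.
Proof.
exists (map_poly (@mpolyC m K) w).[x].
rewrite unlock /= expand_horner //; last first.
  by move=> i; rewrite coef_map; apply: SubalgConst.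
by apply/polyP => i; rewrite !coef_map /= evalvC.
Qed.

Local Notation xL := (evalv p x *: 'X_ord0 + evalv q x *: 'X_ord_max).

Lemma restrict_lineX i :
  restrict_line p q 'X_i = p 0 i *: 'X_ord0 + q 0 i *: 'X_ord_max.
Proof. by rewrite /restrict_line comp_mpolyXU -tnth_nth tnth_mktuple. Qed.

(** On a form of degree d, the parametrization by x is the dehomogenization of
    the parametrization by homogeneous coordinates. *)
Lemma restrict_lineE d f : f \is d.-homog ->
  restrict_line p q f = homogenize xL 'X_ord_max d (line_poly f).
Proof.
move=> hf.
suff [] : restrict_line p q f = homogenize xL 'X_ord_max d (line_poly f)
          /\ (size (line_poly f) <= d.+1)%N by [].
move: d f hf; apply: dhomog_ind => [d|c|i|d f g [ef sf] [eg sg]|d e f g [ef sf] [eg sg]].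
- by rewrite /restrict_line !rmorph0 homogenize0 size_poly0.
- rewrite line_polyC homogenizeC size_polyC; split; last by case: (c == 0).
  by rewrite expr0 alg_mpolyC; apply: comp_mpolyC.
- split; last exact/size_line_poly_homog/dhomogXU.
  rewrite restrict_lineX line_polyX homogenizeD homogenizeZ.
  rewrite -['X]subr0 -polyC0 homogenize_XsubC scale0r subr0.
  rewrite homogenizeC expr1 scalerBl scalerDr !scalerA -addrA [- _ + _]addrC.
  by rewrite -addrA subrr addr0 divfK // addrC.
- rewrite rmorphD /= homogenizeD -ef -eg /restrict_line rmorphD; split=> //.
  by apply: leq_trans (size_polyD _ _) _; rewrite geq_max sf sg.
- rewrite rmorphM /= homogenizeM // -ef -eg /restrict_line rmorphM; split=> //.
  by apply: leq_trans (size_polyMleq _ _) _; lia.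
Qed.

Definition dehomogenize : {mpoly K[2]} -> {poly K} :=
  mmap polyC
    (fun i => if i == ord0 then (evalv p x)^-1 *: ('X - (evalv q x)%:P) else 1).

Lemma dehomogenize_restrict f : dehomogenize (restrict_line p q f) = line_poly f.
Proof.
elim/mpoly_ring_ind: f => [c|i|f g ef eg|f g ef eg].
- by rewrite /restrict_line comp_mpolyC line_polyC /dehomogenize mmapC.
- rewrite restrict_lineX line_polyX /dehomogenize rmorphD /= !mmapZ !mmapX !mmap1U /=.
  by rewrite -!mul_polyC polyCB !polyCM; ring.
- by rewrite /restrict_line /dehomogenize !rmorphD /= -ef -eg.
- by rewrite /restrict_line /dehomogenize !rmorphM /= -ef -eg.
Qed.

End LinePoly.

(** * The fiber over a point as the divisor of one univariate polynomial *)

Section UnivariatePolynomials.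

Variable K : closedFieldType.
Implicit Types g h w : {poly K}.

Lemma poly_ideal_principal (A : {poly K} -> Prop) :
  A 0 -> (forall u v, A u -> A v -> A (u + v)) -> (forall u v, A v -> A (u * v)) ->
  exists g, A g /\ forall w, A w -> g %| w.
Proof.
move=> A0 AD AM.
suff min_elt n w : (size w <= n)%N -> A w -> w != 0 ->
    exists g, A g /\ forall v, A v -> g %| v.
  have [[w [Aw w0]]|noA] := classic (exists w, A w /\ w != 0).
    exact: (min_elt (size w) w).
  exists 0; split=> // w Aw; rewrite dvd0p; apply/negPn/negP => w0.
  by apply: noA; exists w.
elim: n w => [|n IH] w; first by rewrite leqn0 size_poly_eq0 => ->.
move=> le_wn Aw w0.
have [[v [Av v0 lt_vw]]|w_min] :=
  classic (exists v, [/\ A v, v != 0 & (size v < size w)%N]).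
  by apply: (IH v) => //; rewrite -ltnS (leq_trans lt_vw).
exists w; split=> // v Av; apply/modp_eq0P/eqP/negPn/negP => v0.
apply: w_min; exists (v %% w); split=> //; last by rewrite ltn_modp.
rewrite (_ : v %% w = v + - (v %/ w) * w).
  by apply: (AD) => //; apply: (AM).
by rewrite {2}(divp_eq v w) mulNr addrAC subrr add0r.
Qed.

Lemma mup_prod_XsubC_exp e (r : 'I_e -> K) (mu : 'I_e -> nat) z :
  mup z (\prod_i ('X - (r i)%:P) ^+ mu i) = (\sum_(i | r i == z) mu i)%N.
Proof.
rewrite [RHS]big_mkcond /=.
suff [] : mup z (\prod_i ('X - (r i)%:P) ^+ mu i) =
    (\sum_i if r i == z then mu i else 0)%N /\
    \prod_i ('X - (r i)%:P) ^+ mu i != 0 by [].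
elim/big_ind2: _ => [|f1 n1 f2 n2 [e1 nz1] [e2 nz2]|i _].
- by rewrite oner_neq0 mupNroot // root1.
- by rewrite mupM // e1 e2 mulf_neq0.
- by rewrite mup_XsubCX expf_neq0 // polyXsubC_eq0.
Qed.

Lemma size_prod_XsubC_exp e (r : 'I_e -> K) (mu : 'I_e -> nat) :
  size (\prod_i ('X - (r i)%:P) ^+ mu i) = (\sum_i mu i).+1.
Proof.
rewrite size_prod; last by move=> i _; rewrite expf_neq0 // polyXsubC_eq0.
under eq_bigr do rewrite size_exp_XsubC -addn1.
by rewrite big_split /= sum_nat_const muln1 -addSn addnK.
Qed.

(** Both polynomials split, and their lists of roots are permutations of each
    other. *)
Lemma eqp_mup g h : g != 0 -> h != 0 -> (forall z, mup z g = mup z h) -> g %= h.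
Proof.
have [[rg eg] [rh eh]] := (closed_field_poly_normal g, closed_field_poly_normal h).
rewrite -!lead_coef_eq0 => g0 h0 eq_mup.
have mupE (c : K) (r : seq K) z : c != 0 -> mup z (c *: \prod_(y <- r) ('X - y%:P)) = count_mem z r.
  move=> c0; rewrite -mul_polyC mupMr ?mu_prod_XsubC //.
  by rewrite rootC.
have eq_rs : perm_eq rg rh.
  apply/allP => z _ /=; apply/eqP.
  by rewrite -(mupE _ rg z g0) -(mupE _ rh z h0) -eg -eh.
rewrite eg eh (perm_big _ eq_rs) /=.
by rewrite (eqp_trans (eqp_scale _ g0)) // eqp_sym eqp_scale.
Qed.

End UnivariatePolynomials.

Section Fiber.

Variables (K : closedFieldType) (m : nat) (p : 'rV[K]_m) (x : {mpoly K[m]}).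
Hypothesis x_lin : x \is 1.-homog.
Hypothesis xp_neq0 : evalv p x != 0.
Variable I : {mpoly K[m]} -> Prop.
Hypothesis I_homog : homogeneous_ideal I.
Hypothesis p_notin : ~ on_scheme I p.
Variable q : 'rV[K]_m.

Local Notation line_poly := (line_poly p x q).
Local Notation J := (fiber_ideal I p q).

Lemma ideal_form_off_center :
  exists d f, [/\ I f, f \is d.-homog & evalv p f != 0].
Proof.
apply: NNPP => no_form; apply: p_notin => f If d; apply/eqP/negPn/negP => fp.
case: I_homog => _ _ _ Ipi.
by apply: no_form; exists d, (pihomog mdeg d f); split; rewrite ?pihomogP //; apply: Ipi.
Qed.

Lemma evalv_restrict_line (P : 'rV[K]_2) f :
  evalv P (restrict_line p q f) = evalv (P 0 ord0 *: p + P 0 ord_max *: q) f.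
Proof.
rewrite /evalv /restrict_line comp_mpoly_meval; apply: meval_eq => i.
by rewrite tnth_mktuple mevalD !mevalZ !mevalXU !mxE mulrC [q _ _ * _]mulrC.
Qed.

Lemma line_poly_top_coef d f : f \is d.-homog ->
  (line_poly f)`_d * evalv p x ^+ d = evalv p f.
Proof.
move=> hf; pose P : 'rV[K]_2 := \row_i (i == ord0)%:R.
have := evalv_restrict_line P f; rewrite !mxE /= scale1r scale0r addr0 => <-.
rewrite (restrict_lineE q x_lin xp_neq0 hf) /homogenize rmorph_sum /= big_ord_recr /=.
rewrite big1 ?add0r => [|i _].
  rewrite evalvZ subnn mulr1 rmorphXn rmorphD /= !evalvZ !evalvX !mxE /=.
  by rewrite mulr1 mulr0 addr0.
rewrite evalvZ rmorphM !rmorphXn /= evalvX mxE /= expr0n subn_eq0 leqNgt ltn_ord.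
by rewrite !mulr0.
Qed.

(** The polynomial of the fiber: the generator of the ideal that I cuts out on
    the line through p and q. *)
Definition fiber_equation g : Prop :=
  g != 0 /\ forall w, (exists2 f, I f & line_poly f = w) <-> g %| w.

Lemma fiber_equation_exists : exists g, fiber_equation g.
Proof.
case: I_homog => I0 ID IM _.
have [|||g [Ag gP]] := @poly_ideal_principal K (fun w => exists2 f, I f & line_poly f = w).
- by exists 0; rewrite // rmorph0.
- by move=> u v [f If <-] [g Ig <-]; exists (f + g); [exact: ID | rewrite rmorphD].
- move=> u v [f If <-]; have [h <-] := line_poly_surj q x_lin xp_neq0 u.
  by exists (h * f); [exact: IM | rewrite rmorphM].
exists g; split; last first.
  move=> w; split=> [Aw | /dvdpP [a ->]]; first exact: gP.
  case: Ag => f If <-; have [h <-] := line_poly_surj q x_lin xp_neq0 a.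
  by exists (h * f); [exact: IM | rewrite rmorphM].
apply/eqP => g0; have [d [f [If hf /eqP[]]]] := ideal_form_off_center.
rewrite -(line_poly_top_coef hf); have /gP : exists2 f', I f' & line_poly f' = line_poly f.
  by exists f.
by rewrite g0 dvd0p => /eqP ->; rewrite coef0 mul0r.
Qed.

Variable g : {poly K}.
Hypothesis gP : fiber_equation g.

Lemma fiber_equation_dvd f : I f -> g %| line_poly f.
Proof. by move=> If; apply/(proj2 gP); exists f. Qed.

(** The value of x at the point P of the line, and the point where x has a given
    value; the remaining point of the line is p itself. *)
Definition line_coord (P : 'rV[K]_2) : K :=
  (evalv p x * P 0 ord0 + evalv q x * P 0 ord_max) / P 0 ord_max.

Definition line_point (z : K) : 'rV[K]_2 :=
  \row_i (if i == ord0 then (z - evalv q x) / evalv p x else 1).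

Lemma line_point0 z : line_point z 0 ord0 = (z - evalv q x) / evalv p x.
Proof. by rewrite mxE. Qed.

Lemma line_point1 z : line_point z 0 ord_max = 1.
Proof. by rewrite mxE. Qed.

Lemma line_point_neq0 z : line_point z != 0.
Proof.
apply/eqP => /rowP /(_ ord_max); rewrite line_point1 mxE => /eqP.
by rewrite oner_eq0.
Qed.

Lemma line_pointK z : line_coord (line_point z) = z.
Proof.
by rewrite /line_coord line_point0 line_point1 mulr1 divr1 mulrC divfK // subrK.
Qed.

Lemma row2P (P Q : 'rV[K]_2) :
  P 0 ord0 = Q 0 ord0 -> P 0 ord_max = Q 0 ord_max -> P = Q.
Proof.
move=> e0 e1; apply/rowP => -[[|[|i]] lt_i] //.
  by rewrite (_ : Ordinal lt_i = ord0) //; apply: val_inj.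
by rewrite (_ : Ordinal lt_i = ord_max) //; apply: val_inj.
Qed.

Lemma line_coord_eq (P Q : 'rV[K]_2) : P 0 ord_max != 0 -> Q 0 ord_max != 0 ->
  (Q == P)%MS = (line_coord Q == line_coord P).
Proof.
move=> P1 Q1; apply/idP/eqP => [/andP [/sub_rVP [a eQ] _]|eq_c].
  move: Q1; rewrite /line_coord eQ !mxE mulf_eq0 negb_or => /andP [a0 _].
  by field; rewrite a0 P1.
have eP : P 0 ord0 * Q 0 ord_max = Q 0 ord0 * P 0 ord_max.
  apply: (mulfI xp_neq0); move: eq_c; rewrite /line_coord !mulrDl !mulfK // => /addIr.
  move=> /(congr1 (fun c => c * (P 0 ord_max * Q 0 ord_max))) eq_c.
  have -> : evalv p x * (Q 0 ord0 * P 0 ord_max) =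
    evalv p x * Q 0 ord0 / Q 0 ord_max * (P 0 ord_max * Q 0 ord_max) by field.
  by rewrite eq_c; field.
apply/andP; split; apply/sub_rVP.
  exists (Q 0 ord_max / P 0 ord_max); apply: row2P; rewrite mxE; last by field.
  by apply: (mulIf P1); rewrite -eP; field.
exists (P 0 ord_max / Q 0 ord_max); apply: row2P; rewrite mxE; last by field.
by apply: (mulIf Q1); rewrite eP; field.
Qed.

Lemma line_coord_eq_center (P Q : 'rV[K]_2) :
  P 0 ord_max = 0 -> (Q == P)%MS -> Q 0 ord_max = 0.
Proof. by move=> P1 /andP [/sub_rVP [a ->] _]; rewrite mxE P1 mulr0. Qed.

Lemma dehomogenize_point_form (P : 'rV[K]_2) : P 0 ord_max != 0 ->
  dehomogenize p x q (point_form P) =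
  (P 0 ord_max / evalv p x) *: ('X - (line_coord P)%:P).
Proof.
move=> P1; rewrite /dehomogenize /point_form rmorphB /= !mmapZ !mmapX !mmap1U /=.
rewrite -!mul_polyC mulr1 !mulrBr -!polyCM !mulrA -!polyCM.
rewrite -addrA -opprD -polyCD; congr (_ * 'X - _%:P).
by rewrite /line_coord; field; rewrite xp_neq0 P1.
Qed.

(** The components of an element of I are forms on the line, and a form is
    divisible by a power of a linear form that does not vanish at p as soon as
    its dehomogenization is. *)
Lemma vanishes_to_orderE (P : 'rV[K]_2) a : P 0 ord_max != 0 ->
  vanishes_to_order J P a <-> ('X - (line_coord P)%:P) ^+ a %| g.
Proof.
move=> P1; case: I_homog => _ _ _ Ipi; split=> [van|dvd_g].
  have [f If eg] : exists2 f, I f & line_poly f = g by apply/(proj2 gP).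
  have [|h /(congr1 (dehomogenize p x q))] := van (restrict_line p q f).
    by exists f.
  rewrite dehomogenize_restrict // eg => ->.
  have -> : dehomogenize p x q (point_form P ^+ a * h) =
      dehomogenize p x q (point_form P) ^+ a * dehomogenize p x q h.
    by rewrite /dehomogenize rmorphM /= rmorphXn.
  rewrite dehomogenize_point_form // exprZn -scalerAl dvdpZr ?dvdp_mulr //.
  by rewrite expf_neq0 // mulf_neq0 ?invr_eq0.
move=> h [f If ->{h}]; rewrite [f]homogeneous_partition.
rewrite /restrict_line rmorph_sum /=.
elim/big_ind: _ => [|h1 h2 [g1 ->] [g2 ->]|d _].
- by exists 0; rewrite mulr0.
- by exists (g1 + g2); rewrite mulrDr.
have hd := pihomogP mdeg d f.
rewrite -/(restrict_line p q _) (restrict_lineE q x_lin xp_neq0 hd).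
have /(dvdp_trans dvd_g) /dvdpP [w ew] := fiber_equation_dvd (Ipi f d If).
have [w0|w0] := eqVneq w 0.
  by exists 0; rewrite ew w0 mul0r mulr0 homogenize0.
have := size_line_poly_homog p q x_lin hd.
rewrite ew size_Mmonic ?monic_exp ?monicXsubC // size_exp_XsubC addnS /= => le_ad.
have le_a : (a <= d)%N.
  by rewrite -ltnS (leq_trans _ le_ad) // -add1n leq_add2r size_poly_gt0.
rewrite mulrC -(subnKC le_a) homogenize_XsubC_exp; last first.
  by rewrite -subSn // leq_subRL; [rewrite addnC; exact: le_ad | exact: leqW].
rewrite (_ : _ - _ = (evalv p x / P 0 ord_max) *: point_form P); last first.
  rewrite /point_form scalerBr !scalerA divfK // -addrA -scalerBl -[X in _ = _ + X]scaleNr.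
  by congr (_ + _ *: _); rewrite /line_coord; field.
by rewrite exprZn -scalerAl scalerAr; eexists.
Qed.

(** The fiber does not contain p, because some form in I is nonzero there. *)
Lemma not_vanishing_at_center (P : 'rV[K]_2) a :
  P 0 ord_max = 0 -> P != 0 -> ~ vanishes_to_order J P a.+1.
Proof.
move=> P1 nzP van; have [d [f [If hf fp]]] := ideal_form_off_center.
have P0 : P 0 ord0 != 0.
  apply: contra nzP => /eqP P0; apply/eqP; apply: row2P; by rewrite mxE.
have [|h /(congr1 (evalv P))] := van (restrict_line p q f); first by exists f.
rewrite evalv_restrict_line P1 scale0r addr0 (evalv_scale_homog _ _ hf).
rewrite rmorphM rmorphXn /= /point_form rmorphB /= !evalvZ !evalvX P1 mul0r mulr0.
by rewrite subrr expr0n mul0r => /eqP; rewrite mulf_eq0 expf_eq0 (negbTE P0) andbF (negbTE fp).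
Qed.

Lemma multiplicity_atE (P : 'rV[K]_2) a : P != 0 ->
  multiplicity_at J P a <->
  a = if P 0 ord_max == 0 then 0%N else mup (line_coord P) g.
Proof.
move=> nzP; have [g0 _] := gP; rewrite /multiplicity_at.
have [P1|P1] := eqVneq (P 0 ord_max) 0.
  split=> [[]|->]; first by case: a => // a; case/(not_vanishing_at_center P1 nzP).
  split; last exact: not_vanishing_at_center.
  by move=> h _; exists h; rewrite expr0 mul1r.
rewrite !vanishes_to_orderE // -!mup_geq //; split=> [[le_a lt_a]|->].
  by apply/eqP; rewrite eqn_leq le_a leqNgt; apply/negP.
by rewrite leqnn ltnn.
Qed.

Lemma divisor_of_fiber e (mu : 'I_e -> nat) (Q : 'I_e -> 'rV[K]_2) :
  is_divisor J mu Q -> exists r, g %= \prod_i ('X - (r i)%:P) ^+ mu i.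
Proof.
case=> nzQ divQ; exists (fun i => line_coord (Q i)).
apply: eqp_mup => [||z]; first by case: gP.
  by rewrite -size_poly_eq0 size_prod_XsubC_exp.
have /(multiplicity_atE _ (line_point_neq0 z)) := divQ _ (line_point_neq0 z).
rewrite line_point1 oner_eq0 line_pointK => <-; rewrite mup_prod_XsubC_exp.
rewrite big_mkcond [RHS]big_mkcond; apply: eq_bigr => i _ /=.
have [Qi1|Qi1] := eqVneq (Q i 0 ord_max) 0; last first.
  by rewrite line_coord_eq ?line_pointK // line_point1 oner_neq0.
(* A point Q i equal to p carries no multiplicity. *)
suff -> : mu i = 0%N by rewrite !if_same.
have /(multiplicity_atE _ (nzQ i)) := divQ _ (nzQ i).
rewrite Qi1 eqxx (bigD1 i) /=; last by rewrite submx_refl.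
by move/eqP; rewrite addn_eq0 => /andP [/eqP].
Qed.

Lemma fiber_of_divisor e (mu : 'I_e -> nat) (r : 'I_e -> K) :
  g %= \prod_i ('X - (r i)%:P) ^+ mu i ->
  is_divisor J mu (fun i => line_point (r i)).
Proof.
move=> eg; split=> [i|P nzP]; first exact: line_point_neq0.
apply/(multiplicity_atE _ nzP); have [P1|P1] := eqVneq (P 0 ord_max) 0.
  rewrite big1 // => i /(line_coord_eq_center P1) /eqP.
  by rewrite line_point1 oner_eq0.
have -> : mup (line_coord P) g = mup (line_coord P) (\prod_i ('X - (r i)%:P) ^+ mu i).
  have /eqpf_eq [c c0 ->] := eg.
  by rewrite -mul_polyC mupMr // rootC.
rewrite mup_prod_XsubC_exp; apply: eq_bigl => i.
by rewrite line_coord_eq ?line_pointK // line_point1 oner_neq0.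
Qed.

Lemma fiber_length_geE k : fiber_length_ge I p q k <-> (k < size g)%N.
Proof.
split=> [[e [mu [Q [/divisor_of_fiber [r eg] le_k]]]]|lt_k].
  by rewrite (eqp_size eg) size_prod_XsubC_exp ltnS.
have [rs eg] := closed_field_poly_normal g.
have eqg : g %= \prod_(i < size rs) ('X - (tnth (in_tuple rs) i)%:P) ^+ 1.
  under eq_bigr do rewrite expr1.
  rewrite -(big_tnth _ _ _ predT (fun z => 'X - z%:P)) {1}eg eqp_scale //.
  by rewrite lead_coef_eq0; case: gP.
exists (size rs), (fun=> 1%N), (fun i => line_point (tnth (in_tuple rs) i)).
split; first exact: fiber_of_divisor.
by rewrite -ltnS -(size_prod_XsubC_exp (tnth (in_tuple rs))) -(eqp_size eqg).
Qed.

Lemma image_pointP : target_point p q -> (1 < size g)%N -> image_point I p q.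
Proof.
move=> q_tgt lt1g; split=> //.
have /closed_rootP [z gz] : size g != 1 by rewrite gtn_eqF.
pose s := (z - evalv q x) / evalv p x; exists (q + s *: p).
have same_line : (p + (q + s *: p)%R == p + q)%MS.
  apply/andP; split; rewrite addsmx_sub addsmxSl /=.
    by apply: addmx_sub; [exact: addsmxSr | apply/scalemx_sub/addsmxSl].
  rewrite -[X in (X <= _)%MS](addrK (s *: p)) -scaleNr.
  by apply: addmx_sub; [exact: addsmxSr | apply/scalemx_sub/addsmxSl].
split=> //.
  apply: contra q_tgt => le_p; rewrite -[X in (X <= _)%MS](addrK (s *: p)) -scaleNr.
  by apply: addmx_sub => //; apply/scalemx_sub/submx_refl.
case: I_homog => _ _ _ Ipi f If d.
rewrite -(horner_line_poly q xp_neq0) divfK // addrC subrK; apply/eqP.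
by have /dvdpP [w ->] := fiber_equation_dvd (Ipi f d If); rewrite hornerM (rootP gz) mulr0.
Qed.

Lemma ZlamE k e (lam : 'I_e -> nat) : (0 < k)%N -> is_partition k lam ->
  target_point p q ->
  Zlam I p k lam q <->
  (exists r, g %= \prod_i ('X - (r i)%:P) ^+ lam i) \/ (k.+1 < size g)%N.
Proof.
move=> k_gt0 [_ sum_lam] q_tgt; split=> [[[_ [Q /divisor_of_fiber]]|[_ /fiber_length_geE]]|].
- by left.
- by right.
case=> [[r eg]|lt_k]; [left | right].
  split; last by exists (fun i => line_point (r i)); apply: fiber_of_divisor.
  by apply: image_pointP => //; rewrite (eqp_size eg) size_prod_XsubC_exp sum_lam ltnS.
split; last exact/fiber_length_geE.
by apply: image_pointP => //; apply: leq_trans lt_k.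
Qed.

End Fiber.

(** * Elements of the ideal of low degree in x *)

Section LowDegree.

Variables (K : closedFieldType) (m : nat) (p : 'rV[K]_m) (x : {mpoly K[m]}).
Hypothesis x_lin : x \is 1.-homog.
Hypothesis xp_neq0 : evalv p x != 0.

Local Notation expand := (expand p x).

Lemma pseudo_division (h a : {mpoly K[m]}) s : (size (expand h) <= s.+1)%N ->
  exists N b, (size (expand ((expand h)`_s ^+ N * a - b * h)) <= s)%N.
Proof.
set u := (expand h)`_s => size_h.
have expand_coef f i : expand (expand f)`_i = ((expand f)`_i)%:P.
  exact/expand_proj_ring/expand_coef_proj_ring.
move: {2}(size (expand a)) (leqnn (size (expand a))) => n.
elim: n a => [|n IH] a size_a.
  by exists 0%N, 0; rewrite expr0 mul1r mul0r subr0 (leq_trans size_a).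
have [le_ns|lt_sn] := leqP n.+1 s.
  by exists 0%N, 0; rewrite expr0 mul1r mul0r subr0 (leq_trans size_a).
pose c := (expand a)`_n.
have [|N [b le_s]] := IH (u * a - c * x ^+ (n - s) * h).
  apply/leq_sizeP => i le_ni; rewrite rmorphB !rmorphM rmorphXn /=.
  rewrite !expand_coef expand_x // coefB coefCM -mulrA coefCM coefXnM.
  have le_sn : (s <= n)%N by [].
  rewrite ltnNge (leq_trans (leq_subr s n) le_ni) /=.
  case: (ltngtP n i) le_ni => // [lt_ni _|<- _].
    have -> : (expand a)`_i = 0 by move/leq_sizeP: size_a; apply.
    have -> : (expand h)`_(i - (n - s)) = 0 by move/leq_sizeP: size_h; apply; lia.
    by rewrite !mulr0 subrr.
  by rewrite subKn // mulrC subrr.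
exists N.+1, (u ^+ N * c * x ^+ (n - s) + b).
rewrite (_ : _ - _ = u ^+ N * (u * a - c * x ^+ (n - s) * h) - b * h) //.
by rewrite exprS; ring.
Qed.

Variable I : {mpoly K[m]} -> Prop.
Hypothesis I_homog : homogeneous_ideal I.
Hypothesis p_notin : ~ on_scheme I p.
Variable q : 'rV[K]_m.
Variable g : {poly K}.
Hypothesis gP : fiber_equation p x I q g.

Local Notation line_poly := (line_poly p x q).

(** R / I is a finite S-module, because I contains an element that is monic in x
    up to a scalar; its fiber at q is K[X] / (g), generated by the powers of X
    below the degree of g.  By Nakayama's lemma the same powers of x generate
    R / I near q.  The proof makes this explicit: an element of I whose leading
    coefficient does not vanish at q is used to divide a lift of a multiple of g
    of the next smaller degree, until the degree of g is reached. *)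
Lemma low_degree_element :
  exists f, [/\ I f, (size (expand f) <= size g)%N & size (line_poly f) = size g].
Proof.
case: (I_homog) => _ ID IM _; have [g0 dvdgP] := gP.
have [d [F [IF hF Fp]]] := ideal_form_off_center I_homog p_notin.
have line_F : (line_poly F)`_d != 0.
  apply: contraNneq Fp => F0.
  by rewrite -(line_poly_top_coef x_lin xp_neq0 q hF) F0 mul0r.
suff descent t : (size g + t <= d.+1)%N -> exists f,
    [/\ I f, (size (expand f) <= d.+1 - t)%N & size (line_poly f) = (d.+1 - t)%N].
  have le_gd : (size g <= d.+1)%N.
    apply: leq_trans (size_line_poly_homog p q x_lin hF).
    apply: dvdp_leq; last by apply/dvdgP; exists F.
    by apply: contraNneq line_F => ->; rewrite coef0.
  by have := descent (d.+1 - size g)%N; rewrite subnKC // subKn //; apply.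
elim: t => [|t IH] le_t.
  rewrite subn0; exists F; split=> //; first exact: size_expand_homog.
  apply/eqP; rewrite eqn_leq size_line_poly_homog //.
  by rewrite ltnNge; apply: contra line_F => /leq_sizeP ->.
have [|h [Ih size_h size_lh]] := IH; first by lia.
pose s := (d - t)%N; have es : (d.+1 - t = s.+1)%N by rewrite /s; lia.
have le_gs : (size g <= s)%N by rewrite /s; lia.
rewrite es in size_h size_lh; rewrite (_ : d.+1 - t.+1 = s)%N //.
have [a Ia line_a] : exists2 a, I a & line_poly a = g * 'X^(s - size g).
  by apply/dvdgP; apply: dvdp_mulr.
have size_la : size (line_poly a) = s.
  by rewrite line_a size_mulXn // subnK.
have [N [b size_a']] := pseudo_division a size_h.
set u := (expand h)`_s in size_a'; set a' := _ - _ in size_a'.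
have uq : evalv q u != 0.
  rewrite -(coef_line_poly p x) -[s]/(s.+1.-1) -size_lh -lead_coefE lead_coef_eq0.
  by rewrite -size_poly_eq0 size_lh.
have size_lua : size (line_poly (u ^+ N * a)) = s.
  rewrite rmorphM rmorphXn /= line_poly_proj_ring //; last exact: expand_coef_proj_ring.
  by rewrite -polyC_exp mul_polyC size_scale ?expf_neq0.
exists a'; split=> //.
  by rewrite /a' -mulNr; apply: (ID); apply: (IM).
(* The multiple of h cannot contribute to the restriction, for its degree
   would then exceed that of the other two terms. *)
have line_b : line_poly b = 0.
  apply/eqP; apply: contraT => b0.
  have : (size (line_poly b * line_poly h)%R <= s)%N.
    have -> : line_poly b * line_poly h = line_poly (u ^+ N * a) - line_poly a'.
      by rewrite /a' rmorphB opprB addrC subrK rmorphM.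
    apply: leq_trans (size_polyD _ _) _; rewrite size_polyN size_lua geq_max leqnn.
    exact: leq_trans (size_line_poly _ _ _ _) size_a'.
  rewrite size_mul // ?size_lh ?addnS /= => [le_s|]; last by rewrite -size_poly_eq0 size_lh.
  by move: le_s; rewrite -{2}[s]add0n leq_add2r leqn0 size_poly_eq0 (negbTE b0).
by rewrite /a' rmorphB /= [line_poly (b * h)]rmorphM /= line_b mul0r subr0.
Qed.

Hypothesis q_tgt : target_point p q.

Lemma linear_form_nonvanishing :
  exists l, [/\ l \is 1.-homog, proj_ring p l & evalv q l = 1].
Proof.
have [i qi] : exists i, evalv q ('X_i - (p 0 i / evalv p x) *: x) != 0.
  apply: NNPP => all0; case/negP: q_tgt; apply/sub_rVP.
  exists (evalv q x / evalv p x); apply/rowP => i; rewrite !mxE.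
  have [|ne] := eqVneq (evalv q ('X_i - (p 0 i / evalv p x) *: x)) 0; last first.
    by case: all0; exists i.
  rewrite rmorphB /= evalvX evalvZ => /eqP; rewrite subr_eq0 => /eqP ->.
  by rewrite mulrC mulrA [RHS]mulrAC.
have [hl lp] := expandX0_linear_form x_lin xp_neq0 i.
set l := 'X_i - _ in hl lp qi; exists ((evalv q l)^-1 *: l); split.
- exact: dhomogZ.
- rewrite -mul_mpolyC; apply: SubalgMul; first exact: SubalgConst.
  by apply: SubalgGen.
- by rewrite evalvZ mulVf.
Qed.

(** Multiplying the components of an element by powers of a linear form of S
    with value 1 at q makes it homogeneous without changing its restriction to
    the line. *)
Lemma homogeneous_lift f : I f ->
  exists d f', [/\ I f', f' \is d.-homog, (size (expand f') <= size (expand f))%N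
                 & line_poly f' = line_poly f].
Proof.
move=> If; case: (I_homog) => I0 ID IM Ipi.
have [l [hl Sl lq]] := linear_form_nonvanishing.
pose N := msize f; exists N, (\sum_(d < N) l ^+ (N - d) * pihomog mdeg d f); split.
- by elim/big_ind: _ => // d _; apply/(IM)/(Ipi).
- apply: rpred_sum => d _.
  have : l ^+ (N - d) * pihomog mdeg d f \is (1 * (N - d) + d).-homog.
    by apply: dhomogM; [exact: dhomogMn | exact: pihomogP].
  by rewrite mul1n subnK // ltnW.
- apply/leq_sizeP => i le_i; rewrite rmorph_sum coef_sum big1 // => d _.
  rewrite rmorphM rmorphXn /= expand_proj_ring // -polyC_exp coefCM expand_pihomog //.
  by move/leq_sizeP: le_i => -> //; rewrite raddf0 if_same mulr0.
- rewrite [in RHS](homogeneous_partition f) !rmorph_sum; apply: eq_bigr => d _.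
  by rewrite rmorphM rmorphXn /= line_poly_proj_ring // lq expr1n mul1r.
Qed.

Lemma form_of_exact_degree k : (size g <= k.+1)%N ->
  exists d f, [/\ I f, f \is d.-homog, size (expand f) = k.+1
                & size (line_poly f) = k.+1].
Proof.
move=> le_gk; case: (I_homog) => _ _ IM _; have [g0 _] := gP.
have [f0 [If0 size_f0 size_lf0]] := low_degree_element.
pose f1 := f0 * x ^+ (k.+1 - size g).
have nzf0 : line_poly f0 != 0 by rewrite -size_poly_eq0 size_lf0 size_poly_eq0.
have size_lf1 : size (line_poly f1) = k.+1.
  by rewrite rmorphM rmorphXn /= line_poly_x // size_mulXn // size_lf0 subnK.
have size_f1 : (size (expand f1) <= k.+1)%N.
  rewrite rmorphM rmorphXn /= expand_x // size_mulXn; last first.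
    by apply: contraNneq nzf0 => f00; rewrite -size_poly_leq0 -(size_poly0 {mpoly K[m]}) -f00 size_line_poly.
  by apply: leq_trans (leq_add (leqnn _) size_f0) _; rewrite subnK.
have [|d [f [If hf size_f line_f]]] := @homogeneous_lift f1.
  by rewrite /f1 mulrC; apply: (IM).
exists d, f; rewrite line_f; split=> //; apply/eqP; rewrite eqn_leq.
rewrite (leq_trans size_f size_f1) -size_lf1 -line_f; exact: size_line_poly.
Qed.

End LowDegree.

(** * Coincident root loci are closed *)

Section CoincidentRootLocus.

Variables (K : closedFieldType) (k e : nat) (lam : 'I_e -> nat).
Hypothesis lam_part : is_partition k lam.
Implicit Types (a : 'rV[K]_k.+1) (r : 'I_e -> K).

Local Notation root_product r := (\prod_i ('X - (r i)%:P) ^+ lam i).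

Definition form_poly a : {poly K} := \poly_(i < k.+1) a 0 (inord (k - i)).

Lemma coef_form_poly a (j : 'I_k.+1) : (form_poly a)`_(k - j) = a 0 j.
Proof.
rewrite coef_poly ltnS leq_subr subKn; last by rewrite -ltnS.
by congr (a 0 _); apply: val_inj; rewrite /= inordK.
Qed.

Lemma form_poly_rev (w : {poly K}) : (size w <= k.+1)%N ->
  form_poly (\row_j w`_(k - j)) = w.
Proof.
move=> size_w; apply/polyP => i; rewrite coef_poly.
have [lt_ik|le_ki] := ltnP i k.+1; last by move/leq_sizeP: size_w => ->.
by rewrite mxE inordK ?ltnS ?leq_subr // subKn.
Qed.

Lemma binary_formE (L T : {mpoly K[2]}) a :
  \sum_(j < k.+1) a 0 j *: (L ^+ (k - j) * T ^+ j) = homogenize L T k (form_poly a).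
Proof.
rewrite /homogenize (reindex_inj rev_ord_inj) /=; apply: eq_bigr => j _.
by rewrite -coef_form_poly /= !subSS subKn // -ltnS.
Qed.

Lemma root_product_homogenize (L T : {mpoly K[2]}) r :
  homogenize L T k (root_product r) = \prod_i (L - r i *: T) ^+ lam i.
Proof.
case: lam_part => _ <-.
suff prod_seq (s : seq 'I_e) :
    (size (\prod_(i <- s) ('X - (r i)%:P) ^+ lam i)%R <= (\sum_(i <- s) lam i).+1)%N
    /\ homogenize L T (\sum_(i <- s) lam i) (\prod_(i <- s) ('X - (r i)%:P) ^+ lam i)
       = \prod_(i <- s) (L - r i *: T) ^+ lam i.
  by have [] := prod_seq (index_enum _).
elim: s => [|i s [size_s IH]]; first by rewrite !big_nil size_poly1 homogenizeC scale1r.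
rewrite !big_cons homogenize_XsubC_exp // IH; split=> //.
apply: leq_trans (size_polyMleq _ _) _; rewrite size_exp_XsubC addSn /=.
by rewrite -addnS leq_add2l.
Qed.

Lemma coincident_root_locus_of_roots c s r w : c != 0 -> s != 0 ->
  w = c *: root_product r ->
  coincident_root_locus lam (\row_(j < k.+1) (s ^+ j * w`_(k - j))).
Proof.
move=> c0 s0 ew; have [_ sum_lam] := lam_part.
have size_r : size (root_product r) = k.+1 by rewrite size_prod_XsubC_exp sum_lam.
have wk : w`_k = c.
  have mon : root_product r \is monic.
    by apply: monic_prod => i _; apply/monic_exp/monicXsubC.
  by move/monicP: mon; rewrite ew coefZ lead_coefE size_r /= => ->; rewrite mulr1.
split.
  apply/eqP => /rowP /(_ ord0); rewrite !mxE /= mul1r subn0 wk => /eqP.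
  exact/negP.
exists c, (fun i => 'X_ord0 - r i *: (s *: 'X_ord_max)); split=> //.
  by move=> i; apply: rpredB; [exact: dhomogXU | do 2 apply: dhomogZ; exact: dhomogXU].
rewrite -root_product_homogenize -homogenizeZ -ew -[w in RHS]form_poly_rev; last first.
  by rewrite ew size_scale // size_r.
rewrite -binary_formE /binary_form; apply: eq_bigr => j _.
by rewrite !mxE exprZn -scalerAr scalerA mulrC.
Qed.

Lemma scale_coincident_root_locus a c : c != 0 ->
  coincident_root_locus lam a -> coincident_root_locus lam (c *: a).
Proof.
move=> c0 [a0 [d [L [d0 hL eL]]]]; split; first by rewrite scaler_eq0 negb_or c0.
exists (c * d), L; split; rewrite ?mulf_neq0 // -scalerA -eL scaler_sumr.
by apply: eq_bigr => j _; rewrite mxE scalerA.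
Qed.

Lemma coincident_root_locus_roots a :
  coincident_root_locus lam a -> a 0 ord0 != 0 ->
  exists r, form_poly a = a 0 ord0 *: root_product r.
Proof.
case=> _ [c [L [c0 hL eL]]] a0; have [lam_gt0 sum_lam] := lam_part.
pose dehom := mmap polyC (fun i : 'I_2 => if i == ord0 then 'X else 1 : {poly K}).
pose u i := (L i)@_U_(ord0); pose v i := (L i)@_U_(ord_max).
have dehomL i : dehom (L i) = u i *: 'X + (v i)%:P.
  rewrite /dehom {1}(linear_formE (hL i)) rmorph_sum /= !big_ord_recl big_ord0.
  rewrite addr0 !mmapZ !mmapX !mmap1U /= mulr1 mul_polyC.
  by rewrite (_ : lift ord0 ord0 = ord_max) //; apply: val_inj.
have dehom_form : form_poly a = c *: \prod_i (u i *: 'X + (v i)%:P) ^+ lam i.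
  under [in RHS]eq_bigr do rewrite -dehomL.
  have -> : c *: \prod_i dehom (L i) ^+ lam i = dehom (c *: \prod_i L i ^+ lam i).
    rewrite /dehom mmapZ rmorph_prod mul_polyC /=.
    by congr (_ *: _); apply: eq_bigr => i _; rewrite rmorphXn.
  rewrite -eL /dehom /binary_form rmorph_sum /= /form_poly poly_def.
  rewrite [RHS](reindex_inj rev_ord_inj) /=; apply: eq_bigr => j _.
  rewrite mmapZ rmorphM !rmorphXn /= !mmapX !mmap1U /= expr1n mulr1 mul_polyC subSS.
  rewrite subKn; last by rewrite -ltnS.
  congr (a 0 _ *: _).
  by apply: val_inj; rewrite /= inordK ?subSS // ltnS leq_subr.
(* The leading coefficient of the binary form is c times the product of the
   leading coefficients of its factors, so no factor is a multiple of the
   second variable. *)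
have u0 i : u i != 0.
  apply: contraNneq a0 => ui0; rewrite -(coef_form_poly a ord0) subn0 dehom_form.
  rewrite nth_default // (leq_trans (size_scale_leq _ _)) //.
  rewrite (bigD1 i) //= ui0 scale0r add0r -polyC_exp mul_polyC.
  apply: leq_trans (size_scale_leq _ _) _.
  apply: (@leq_trans (\sum_(j | j != i) lam j).+1); last first.
    by rewrite -sum_lam [X in (_ <= X)%N](bigD1 i) //= -add1n leq_add2r.
  elim/big_ind2: _ => [|f1 n1 f2 n2 s1 s2|j _]; first by rewrite size_poly1.
    by apply: leq_trans (size_polyMleq _ _) _; lia.
  apply: leq_trans (size_poly_exp_leq _ _) _; rewrite ltnS -[X in (_ <= X)%N]mul1n leq_mul2r.
  apply/orP; right; rewrite -subn1 leq_subLR addn1.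
  apply: leq_trans (size_polyD _ _) _; rewrite geq_max.
  rewrite (leq_trans (size_scale_leq _ _)) ?size_polyX // size_polyC.
  by case: (v j == 0).
exists (fun i => - (v i / u i)).
have form_c : form_poly a = (c * \prod_i u i ^+ lam i) *: root_product (fun i => - (v i / u i)).
  rewrite dehom_form -scalerA; congr (_ *: _).
  rewrite -mul_polyC rmorph_prod -big_split; apply: eq_bigr => i _ /=.
  rewrite polyC_exp -exprMn mul_polyC polyCN opprK scalerDr; congr ((_ + _) ^+ _).
  by rewrite -mul_polyC -polyCM mulrCA divff // mulr1.
rewrite {1}form_c; congr (_ *: _); rewrite -(coef_form_poly a ord0) subn0 form_c coefZ.
have /monicP : root_product (fun i => - (v i / u i)) \is monic.
  by apply: monic_prod => i _; apply/monic_exp/monicXsubC.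
by rewrite lead_coefE size_prod_XsubC_exp sum_lam /= => ->; rewrite mulr1.
Qed.

Lemma partition_blocks : exists t : k.-tuple 'I_e,
  forall F : 'I_e -> {poly K}, \prod_(j < k) F (tnth t j) = \prod_i F i ^+ lam i.
Proof.
pose s := flatten [seq nseq (lam i) i | i <- index_enum 'I_e].
have size_s : size s == k.
  case: lam_part => _ <-; rewrite size_flatten sumnE !big_map; apply/eqP.
  by apply: eq_bigr => i _; rewrite size_nseq.
exists (Tuple size_s) => F; rewrite -(big_tuple _ _ (Tuple size_s) predT F) /=.
rewrite big_flatten big_map; apply: eq_bigr => i _.
by rewrite big_nseq; elim: (lam i) => //= n ->; rewrite exprS.
Qed.

Lemma meval_msym n (s : 'S_n) (f : {mpoly K[n]}) (b : 'I_n -> K) :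
  (msym s f).@[b] = f.@[fun i => b (s i)].
Proof.
elim/mpoly_ring_ind: f => [c|i|f g ef eg|f g ef eg].
- by rewrite /msym mmapC !mevalC.
- by rewrite /msym mmapX mmap1U !mevalXU.
- by rewrite rmorphD !mevalD /= ef eg.
- by rewrite rmorphM !mevalM /= ef eg.
Qed.

(** If no reordering of b is constant on the blocks of the partition, each
    reordering is detected by one of the differences X_j - X_(j'), j' being the
    chosen index in the block of j, hence by the combination of these
    differences with the powers of a general parameter as coefficients.  The
    product of this linear form over the symmetric group is symmetric. *)
Lemma symmetric_separation (t : k.-tuple 'I_e) (b : 'I_k -> K) :
  (forall r, \prod_j ('X - (b j)%:P) <> \prod_j ('X - (r (tnth t j))%:P)) ->
  exists2 G : {mpoly K[k]}, G \is mpoly.symmetric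
    & G.@[b] != 0 /\ forall r, G.@[fun j => r (tnth t j)] = 0.
Proof.
move=> no_r; pose mate j := odflt j [pick j' | tnth t j' == tnth t j].
have t_mate j : tnth t (mate j) = tnth t j.
  by rewrite /mate; case: pickP => [j' /eqP|].
pose D (s : 'S_k) := \poly_(j < k) oapp (fun j' => b (s j') - b (s (mate j'))) 0 (insub j).
have coefD s (j : 'I_k) : (D s)`_j = b (s j) - b (s (mate j)).
  by rewrite coef_poly ltn_ord valK.
have D0 s : D s != 0.
  apply/eqP => Ds; pose r i := oapp (fun j => b (s j)) 0 [pick j | tnth t j == i].
  apply: (no_r r); rewrite (reindex_inj (@perm_inj _ s)); apply: eq_bigr => j _.
  have /eqP := coefD s j; rewrite Ds coef0 eq_sym subr_eq0 => /eqP ->.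
  rewrite /r /mate; case: pickP => //= /(_ j).
  by rewrite eqxx.
have /closed_nonrootP [c] : \prod_s D s != 0 by apply/prodf_neq0.
rewrite /root horner_prod => /prodf_neq0 Dc.
pose L : {mpoly K[k]} := \sum_(j < k) c ^+ j *: ('X_j - 'X_(mate j)).
exists (\prod_s msym s L).
  apply/issymP => s; rewrite rmorph_prod /= [RHS](reindex_inj (@mulIg _ s)) /=.
  by apply: eq_bigr => s' _; rewrite msymMm.
have evalL s v : (msym s L).@[v] = \sum_(j < k) (v (s j) - v (s (mate j))) * c ^+ j.
  rewrite meval_msym rmorph_sum; apply: eq_bigr => j _ /=.
  by rewrite mevalZ mevalB !mevalXU mulrC.
split=> [|r]; rewrite rmorph_prod /=.
  apply/prodf_neq0 => s _; rewrite evalL; have := Dc s isT; rewrite horner_poly.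
  by under eq_bigr => j _ do rewrite valK /=.
rewrite (bigD1 1%g) //= evalL big1 ?mul0r // => j _.
by rewrite !perm1 t_mate subrr mul0r.
Qed.

(** G is a polynomial in the elementary symmetric functions, which by Vieta are,
    up to sign, the coefficients of a polynomial divided by its leading
    coefficient; F clears these denominators.  The exponent of the leading
    variable is kept positive in every term, so that F also vanishes on the
    forms of degree less than k in the first variable. *)
Lemma homogenized_symmetric (G : {mpoly K[k]}) : G \is mpoly.symmetric ->
  exists F : {mpoly K[k.+1]},
    (forall a, a 0 ord0 = 0 -> evalv a F = 0) /\
    (forall a (b : 'I_k -> K), a 0 ord0 != 0 ->
       form_poly a = a 0 ord0 *: \prod_j ('X - (b j)%:P) ->
       exists2 c, c != 0 & evalv a F = c * G.@[b]).
Proof.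
case/sym_fundamental => T [GE _]; pose N := msize T.
pose y (a : 'rV[K]_k.+1) (i : 'I_k) := (-1) ^+ i.+1 * a 0 (lift ord0 i).
exists (\sum_(mm <- msupp T) T@_mm *:
  (\prod_(i < k) ((-1) ^+ i.+1 *: 'X_(lift ord0 i)) ^+ mm i * 'X_ord0 ^+ (N - mdeg mm))).
set F := \sum_(mm <- _) _.
have evalF a : evalv a F = \sum_(mm <- msupp T)
    T@_mm * (\prod_(i < k) y a i ^+ mm i * a 0 ord0 ^+ (N - mdeg mm)).
  rewrite /F rmorph_sum /=; apply: eq_bigr => mm _.
  rewrite evalvZ rmorphM rmorphXn rmorph_prod /= evalvX; congr (_ * (_ * _)).
  by apply: eq_bigr => i _; rewrite rmorphXn /= evalvZ evalvX.
split=> [a a0|a b a0 form_a].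
  rewrite evalF big_seq big1 // => mm /msize_mdeg_lt lt_mm.
  by rewrite a0 expr0n subn_eq0 leqNgt lt_mm !mulr0.
exists (a 0 ord0 ^+ N); first exact: expf_neq0.
have elem_b (i : 'I_k) : (mesym k K i.+1).@[b] = y a i / a 0 ord0.
  have := mroots_coeff [tuple b j | j < k] (lift ord0 i).
  rewrite big_tuple lift0.
  under eq_bigr do rewrite tnth_mktuple.
  have -> : (\prod_j ('X - (b j)%:P))`_(k - i.+1) = a 0 (lift ord0 i) / a 0 ord0.
    by apply: (mulfI a0); rewrite -coefZ -form_a mulrC divfK // -lift0 coef_form_poly.
  move=> eq_i; rewrite /y -mulrA eq_i mulrA -exprMn mulrNN mulr1 expr1n mul1r.
  by apply: meval_eq => j; rewrite tnth_mktuple.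
rewrite -GE comp_mpoly_meval evalF [in RHS]mevalE mulr_sumr !big_seq.
apply: eq_bigr => mm /msize_mdeg_lt lt_mm; rewrite [RHS]mulrCA; congr (_ * _).
under [in RHS]eq_bigr do rewrite tnth_mktuple elem_b exprMn.
rewrite big_split /= [RHS]mulrCA; congr (_ * _).
under eq_bigr do rewrite exprVn.
by rewrite prodfV prodrXr -mdegE expfB.
Qed.

Lemma coincident_root_locus_closed a :
  a 0 ord0 != 0 ->
  (forall F, vanishing_ideal (coincident_root_locus lam) F -> evalv a F = 0) ->
  exists r, form_poly a = a 0 ord0 *: root_product r.
Proof.
move=> a0 vanF; apply: NNPP => no_r.
have [t tP] := partition_blocks.
have [bs bsE] := closed_field_poly_normal (form_poly a).
have top_a : (form_poly a)`_k = a 0 ord0 by rewrite -(coef_form_poly a ord0) subn0.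
have size_a : size (form_poly a) = k.+1.
  apply/eqP; rewrite eqn_leq size_poly ltnNge; apply: contra a0 => /leq_sizeP.
  by rewrite -top_a => ->.
have lead_a : lead_coef (form_poly a) = a 0 ord0 by rewrite lead_coefE size_a.
have size_bs : size bs == k.
  by move: size_a; rewrite bsE lead_a size_scale // size_prod_XsubC => -[->].
pose b := tnth (Tuple size_bs).
have form_a : form_poly a = a 0 ord0 *: \prod_j ('X - (b j)%:P).
  by rewrite {1}bsE lead_a -(big_tuple _ _ (Tuple size_bs) predT (fun z => 'X - z%:P)).
have [r eq_r|G symG [Gb Gr]] := @symmetric_separation t b.
  by apply: no_r; exists r; rewrite form_a eq_r (tP (fun i => 'X - (r i)%:P)).
have [F [F0 FG]] := homogenized_symmetric symG.
have [c c0 Fa] := FG a b a0 form_a.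
have /eqP[] : c * G.@[b] != 0 by rewrite mulf_neq0.
rewrite -Fa; apply: vanF => a' a'_in; apply/point_idealP => s s0.
have {}a'_in := scale_coincident_root_locus s0 a'_in.
have [/F0 //|a'0] := eqVneq ((s *: a') 0 ord0) 0.
have [r eq_r] := coincident_root_locus_roots a'_in a'0.
have [|d _ ->] := FG _ (fun j => r (tnth t j)) a'0; last by rewrite Gr mulr0.
by rewrite eq_r (tP (fun i => 'X - (r i)%:P)).
Qed.

End CoincidentRootLocus.

(** * Generators of the ramification ideal *)

Section Generators.

Variables (K : closedFieldType) (m : nat) (p : 'rV[K]_m).

Lemma evalv_eval_coefs (k : nat) (u : 'rV[K]_m) (F : {mpoly K[k.+1]})
    (c : {poly {mpoly K[m]}}) :
  evalv u (eval_coefs F c) = evalv (\row_j evalv u c`_(k - j)) F.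
Proof.
elim/mpoly_ring_ind: F => [a|i|F G eF eG|F G eF eG].
- by rewrite /eval_coefs mmapC !evalvC.
- by rewrite /eval_coefs mmapX mmap1U evalvX mxE.
- by rewrite /eval_coefs !rmorphD /= -eF -eG.
- by rewrite /eval_coefs !rmorphM /= -eF -eG.
Qed.

Lemma eval_coefs_proj_ring (k : nat) (F : {mpoly K[k.+1]})
    (c : {poly {mpoly K[m]}}) :
  (forall i, proj_ring p c`_i) -> proj_ring p (eval_coefs F c).
Proof.
move=> hc; apply: proj_ring_sum => mm _; apply: SubalgMul; first exact: SubalgConst.
by apply: proj_ring_prod => i _; apply: proj_ringX.
Qed.

Lemma ideal_gen_target_point_ideal (q : 'rV[K]_m) (G : {mpoly K[m]} -> Prop) :
  (forall f, G f -> target_point_ideal p q f) ->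
  forall f, ideal_gen (proj_ring p) G f -> target_point_ideal p q f.
Proof.
move=> hG f; elim=> {f} [f /hG //||f g _ [Sf fq] _ [Sg gq]|s f Ss _ [Sf fq]].
- by split; [exact: proj_ring0 | move=> d; rewrite !raddf0].
- by split; [exact: SubalgAdd | move=> d; rewrite !raddfD /= fq gq addr0].
split; first exact: SubalgMul.
by apply/point_idealP => c _; rewrite rmorphM /= (point_ideal_scale c fq) mulr0.
Qed.

Lemma vanishing_at_zero (k e : nat) (lam : 'I_e -> nat) (F : {mpoly K[k.+1]}) :
  is_partition k lam -> vanishing_ideal (coincident_root_locus lam) F ->
  evalv 0 F = 0.
Proof.
move=> lam_part vanF.
have := coincident_root_locus_of_roots lam_part (oner_neq0 K) (oner_neq0 K)
  (esym (scale1r (\prod_i ('X - (0 : K)%:P) ^+ lam i))).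
by move/vanF/(point_ideal_scale 0); rewrite scale0r.
Qed.

Variable x : {mpoly K[m]}.
Hypothesis x_lin : x \is 1.-homog.
Hypothesis xp_neq0 : evalv p x != 0.
Variable I : {mpoly K[m]} -> Prop.
Hypothesis I_homog : homogeneous_ideal I.
Hypothesis p_notin : ~ on_scheme I p.
Variable q : 'rV[K]_m.
Hypothesis q_tgt : target_point p q.
Variable g : {poly K}.
Hypothesis gP : fiber_equation p x I q g.

Lemma line_poly_small f : I f ->
  (size (expand p x f) < size g)%N -> line_poly p x q f = 0.
Proof.
move=> If lt_fg; apply/eqP; apply: contraTT lt_fg => nz; rewrite -leqNgt.
apply: leq_trans (size_line_poly p x q f); apply: dvdp_leq => //.
exact: (fiber_equation_dvd gP).
Qed.

(** An element of I of degree at most j in x restricts to a multiple of g of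
    smaller degree, hence to zero.  The argument is applied to the homogeneous
    components of the element, which again lie in I. *)
Lemma partial_elimination_vanishes j f0 : (j.+1 < size g)%N ->
  partial_elimination_ideal I p x j f0 -> point_ideal q f0.
Proof.
move=> lt_jg [Sf0 [ct [ft [/(x_expansionP x_lin xp_neq0) ect size_ct If]]]] d.
case: (I_homog) => _ _ _ Ipi.
set f := _ + ft in If.
have ef : expand p x f = 'X^j * f0%:P + ct.
  by rewrite rmorphD rmorphM rmorphXn /= expand_x // expand_proj_ring // ect.
have ef_j : (expand p x f)`_j = f0.
  rewrite ef coefD coefXnM ltnn subnn coefC /=.
  by move/leq_sizeP: size_ct => -> //; rewrite addr0.
have size_f : (size (expand p x f) <= j.+1)%N.
  apply/leq_sizeP => i lt_ji; rewrite ef coefD coefXnM ltnNge (ltnW lt_ji) /= coefC.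
  move/leq_sizeP: size_ct => ->; last exact: ltnW.
  by rewrite subn_eq0 leqNgt lt_ji addr0.
pose fd := pihomog mdeg (d + j) f.
have /(congr1 (fun w : {poly K} => w`_j)) : line_poly p x q fd = 0.
  apply: line_poly_small; first exact: Ipi.
  apply: leq_ltn_trans (lt_jg); apply/leq_sizeP => i lt_ji.
  rewrite expand_pihomog //; move/leq_sizeP: size_f => -> //.
  by rewrite raddf0 if_same.
by rewrite /= coef0 coef_line_poly expand_pihomog // leq_addl addnK ef_j.
Qed.

(** When the fiber is short, I contains a form of degree exactly j in x whose
    leading coefficient does not vanish at q; that coefficient is the witness. *)
Lemma partial_elimination_nonvanishing j : (size g <= j.+1)%N ->
  exists2 f0, partial_elimination_ideal I p x j f0 & evalv q f0 != 0.
Proof.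
move=> le_gj.
have [d [f [If hf size_f size_lf]]] :=
  form_of_exact_degree x_lin xp_neq0 I_homog p_notin gP q_tgt le_gj.
exists (expand p x f)`_j; last first.
  rewrite -(coef_line_poly p x) -[j]/(j.+1.-1) -size_lf -lead_coefE lead_coef_eq0.
  by rewrite -size_poly_eq0 size_lf.
split; first exact: expand_coef_proj_ring.
exists (take_poly j (expand p x f)), (take_poly j (expand p x f)).[x]; split.
- split=> // i; rewrite coef_take_poly; case: ltnP => _; last exact: proj_ring0.
  exact: expand_coef_proj_ring.
- exact: size_take_poly.
suff -> : x ^+ j * (expand p x f)`_j + (take_poly j (expand p x f)).[x] = f by [].
rewrite -[RHS](horner_expand p x) [in RHS]horner_coef size_f big_ord_recr /= addrC.
rewrite [in RHS]mulrC; congr (_ + _); rewrite (horner_coef_wide _ (size_take_poly _ _)).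
by apply: eq_bigr => i _; rewrite coef_take_poly ltn_ord.
Qed.

Variables (k e : nat) (lam : 'I_e -> nat).
Hypothesis lam_part : is_partition k lam.
Hypothesis lt_kg : (k < size g)%N.
Hypothesis g_roots :
  (exists r, g %= \prod_i ('X - (r i)%:P) ^+ lam i) \/ (k.+1 < size g)%N.

(** The coefficients at q of a form f in I of degree k in x are either all zero
    or, by comparing degrees, those of a scalar multiple of g.  Passing from q to s q
    rescales them by powers of s, which amounts to scaling one variable of the
    binary form and preserves its root multiplicities. *)
Lemma coincident_root_generator_vanishes (F : {mpoly K[k.+1]}) c :
  vanishing_ideal (coincident_root_locus lam) F -> ideal_deg_x I p x k c ->
  point_ideal q (eval_coefs F c).
Proof.
move=> vanF [f [If /homogP [d hf] /(x_expansionP x_lin xp_neq0) -> size_f]].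
apply/point_idealP => s s0; rewrite evalv_eval_coefs.
have le_kd : (k <= d)%N by rewrite -ltnS -size_f (size_expand_homog p x_lin hf).
pose w := line_poly p x q f.
have -> : \row_j evalv (s *: q) (expand p x f)`_(k - j) =
    s ^+ (d - k) *: \row_(j < k.+1) (s ^+ j * w`_(k - j)).
  apply/rowP => j; rewrite !mxE.
  rewrite (evalv_scale_homog _ _ (expand_homog_coef p x_lin (k - j) hf)).
  rewrite coef_line_poly mulrA -exprD; congr (_ ^+ _ * _).
  by have := ltn_ord j; lia.
have [w0|w0] := eqVneq w 0.
  rewrite (_ : \row__ _ = 0) ?scaler0 ?(vanishing_at_zero lam_part) //.
  by apply/rowP => j; rewrite !mxE w0 coef0 mulr0.
have dvd_gw : g %| w by apply: (fiber_equation_dvd gP).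
have le_wk : (size w <= k.+1)%N by rewrite -size_f; apply: size_line_poly.
case: g_roots => [[r eg]|lt_k]; last first.
  by have := leq_trans (dvdp_leq w0 dvd_gw) le_wk; rewrite leqNgt lt_k.
have eq_gw : g %= w.
  rewrite -dvdp_size_eqp // eqn_leq dvdp_leq //=.
  exact: leq_trans le_wk lt_kg.
have /eqpf_eq [b b0 ew] : w %= \prod_i ('X - (r i)%:P) ^+ lam i.
  by apply: eqp_trans eg; rewrite eqp_sym.
apply/point_ideal_scale/vanF.
exact: (coincident_root_locus_of_roots lam_part b0 s0 ew).
Qed.

End Generators.

(** * The ramification locus *)

Theorem theorem3p1 (K : closedFieldType) (charK : [pchar K] =i pred0)
  (n : nat) (n_gt0 : (0 < n)%N)
  (I : {mpoly K[n.+1]} -> Prop)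
  (I_homog : homogeneous_ideal I) (I_sat : saturated_ideal I)
  (p : 'rV[K]_n.+1) (p_neq0 : p != 0) (p_notin_Z : ~ on_scheme I p)
  (x : {mpoly K[n.+1]}) (x_lin : x \is 1.-homog)
  (x_notin_p1 : ~ linear_forms_at p x)
  (k : nat) (k_gt0 : (0 < k)%N)
  (e : nat) (lam : 'I_e -> nat) (lam_part : is_partition k lam) :
  set_theoretically_defined p (Zlam I p k lam)
    (ramification_ideal I p x k lam).
Proof.
move=> q q_tgt.
have xp0 : evalv p x != 0.
  by apply/eqP => xp; apply: x_notin_p1; split; last exact: (point_ideal_homog x_lin).
have [g gP] := fiber_equation_exists x_lin xp0 I_homog p_notin_Z q.
rewrite (ZlamE x_lin xp0 I_homog p_notin_Z gP k_gt0 lam_part q_tgt).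
split=> [g_roots|vanJ].
  have lt_kg : (k < size g)%N.
    case: g_roots => [[r eg]|]; last exact: ltnW.
    by rewrite (eqp_size eg) size_prod_XsubC_exp (proj2 lam_part).
  apply: ideal_gen_target_point_ideal => f [[F [c [vanF hc ->]]]|hf]; split.
  - apply: eval_coefs_proj_ring => i; case: hc => f' [_ _ [Sc _] _]; exact: Sc.
  - exact: (coincident_root_generator_vanishes x_lin xp0 gP lam_part lt_kg g_roots vanF hc).
  - by case: hf.
  - by apply: (partial_elimination_vanishes x_lin xp0 I_homog gP _ hf); rewrite prednK.
have lt_kg : (k < size g)%N.
  rewrite ltnNge; apply/negP => le_gk.
  have [|f0 hf0 /eqP[]] := partial_elimination_nonvanishing x_lin xp0 I_homog p_notin_Z
    q_tgt gP (j := k.-1); first by rewrite prednK.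
  by apply: point_ideal_eval; have [] := vanJ f0 (IdealGen _ (or_intror hf0)).
have [|le_gk] := ltnP k.+1 (size g); [by right | left].
have [d [f [If hf size_f size_lf]]] :=
  form_of_exact_degree x_lin xp0 I_homog p_notin_Z gP q_tgt le_gk.
pose w := line_poly p x q f; pose a := \row_(j < k.+1) w`_(k - j).
have a0 : a 0 ord0 != 0.
  rewrite mxE subn0 -[k]/(k.+1.-1) -size_lf -lead_coefE lead_coef_eq0.
  by rewrite -size_poly_eq0 size_lf.
have [F vanF|r form_a] := coincident_root_locus_closed lam_part a0.
  have -> : a = \row_j evalv q (expand p x f)`_(k - j).
    by apply/rowP => j; rewrite !mxE coef_line_poly.
  rewrite -evalv_eval_coefs; apply: point_ideal_eval.
  have [] // := vanJ (eval_coefs F (expand p x f)); apply: IdealGen; left.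
  exists F, (expand p x f); split=> //; exists f; split=> //.
    by apply/homogP; exists d.
  exact/(x_expansionP x_lin xp0).
exists r.
have ew : w = a 0 ord0 *: \prod_i ('X - (r i)%:P) ^+ lam i.
  by rewrite -form_a form_poly_rev // size_lf.
apply: (@eqp_trans _ w); last by rewrite ew eqp_scale.
rewrite -dvdp_size_eqp; last exact: (fiber_equation_dvd gP).
by rewrite size_lf eqn_leq le_gk.
Qed.
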